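(* Let $k\ge1$, $c,r\ge1$ with $c+r=k+1$ and $R=(c^r)$. Then for every $i\in\{0,1,\dots,k\}$, in the affine nilCoxeter algebra, $$s_R^{(k)}u_i=u_{i+c}\,s_R^{(k)},$$ where $i+c$ is taken modulo $k+1$.
   Context: Indices are modulo $k+1$. $W$ is the affine symmetric group with generators $s_0,\dots,s_k$ (relations $s_i^2=1$, $s_is_j=s_js_i$ if $i-j\not\equiv\pm1$, $s_is_{i+1}s_i=s_{i+1}s_is_{i+1}$). The affine nilCoxeter algebra $\mathbb{A}$ has generators $u_0,\dots,u_k$, relations $u_i^2=0$, $u_iu_j=u_ju_i$ if $i-j\not\equiv\pm1$, $u_iu_{i+1}u_i=u_{i+1}u_iu_{i+1}$; for $w\in W$ with reduced word $s_{i_1}\cdots s_{i_m}$, ${\bf u}(w)=u_{i_1}\cdots u_{i_m}$. The content of the box in row $i$, column $j$ is $(j-i)\bmod(k+1)$. $W$ acts on $(k+1)$-cores: $s_i\nu$ adds all addable boxes of content $i$ if any, removes all removable boxes of content $i$ if any, else is $\nu$. $W_0=\langle s_1,\dots,s_k\rangle$, $W^0$ = minimal length coset representatives of $W/W_0$. A partition $\lambda$ is $k$-bounded if $\lambda_1\le k$; $\mathfrak{c}(\lambda)$ is the $(k+1)$-core corresponding to it under the Lapointe–Morse bijection (inverse: core $\mapsto$ partition whose $i$-th part is the number of cells in row $i$ of hook length $\le k$); $w_\lambda\in W^0$ satisfies $w_\lambda\emptyset=\mathfrak{c}(\lambda)$, and $u_\lambda={\bf u}(w_\lambda)$. For $D\subsetneq\{0,\dots,k\}$,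 $u_D$ is the product of $u_m$, $m\in D$, each once, with $u_{j+1}$ left of $u_j$ whenever $j,j+1\in D$. ${\bf h}_i=\sum_{|D|=i}u_D$. The $k$-Schur functions $s^{(k)}_\lambda$ are the unique elements of the subalgebra generated by ${\bf h}_1,\dots,{\bf h}_k$ with $s^{(k)}_\emptyset=1$ and ${\bf h}_is^{(k)}_\lambda=\sum_\mu s^{(k)}_\mu$, summed over $k$-bounded $\mu$ with $u_\mu=u_Du_\lambda$ for some $|D|=i$.
   Formalization: For k=1 the braid relations s_i s_{i+1} s_i = s_{i+1} s_i s_{i+1} and u_i u_{i+1} u_i = u_{i+1} u_i u_{i+1} are not imposed (W is infinite dihedral), since with them W would not act on 2-cores; for k≥2 all relations are as stated. *)

(* Defs.v *)
From HB Require Import structures.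
From mathcomp Require Import all_boot all_order all_algebra.
From mathcomp Require Import boolp classical_sets fsbigop.
From mathcomp.multinomials Require Import monalg.

Set Implicit Arguments.
Unset Strict Implicit.
Unset Printing Implicit Defensive.

Import GRing.Theory.
Local Open Scope ring_scope.
Local Open Scope quotient_scope.

(* The index set Z/(k+1) is 'I_k.+1 with its zmodType structure (addition
   modulo k+1); [inZp n] is the class of n.  ('Z_k.+1 is not used, so that the
   modulus is k+1 without any side condition.)                                *)

Definition adjacent (k : nat) (i j : 'I_k.+1) : bool :=
  (i - j == inZp 1) || (j - i == inZp 1).

Section AffineSymmetricGroup.
Variable k : nat.
Implicit Types (i j : 'I_k.+1) (s t x y : seq 'I_k.+1).

(* For k = 1 there is no braid relation: i + 1 = i - 1 and the affine symmetric
   group is the infinite dihedral group.                                      *)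
Inductive coxeter_rel : seq 'I_k.+1 -> seq 'I_k.+1 -> Prop :=
| coxeter_rel_sq i : coxeter_rel [:: i; i] [::]
| coxeter_rel_comm i j : ~~ adjacent i j -> coxeter_rel [:: i; j] [:: j; i]
| coxeter_rel_braid i : (1 < k)%N ->
    coxeter_rel [:: i; i + inZp 1; i] [:: i + inZp 1; i; i + inZp 1].

Inductive coxeter_eq : seq 'I_k.+1 -> seq 'I_k.+1 -> Prop :=
| coxeter_eq_rel x s t y : coxeter_rel s t ->
    coxeter_eq (x ++ s ++ y) (x ++ t ++ y)
| coxeter_eq_refl s : coxeter_eq s s
| coxeter_eq_sym s t : coxeter_eq s t -> coxeter_eq t s
| coxeter_eq_trans s t x : coxeter_eq s t -> coxeter_eq t x -> coxeter_eq s x.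

Lemma coxeter_eq_ctx x y s t :
  coxeter_eq s t -> coxeter_eq (x ++ s ++ y) (x ++ t ++ y).
Proof.
elim=> {s t} [z s t w st|s|s t _|s t v _ st _].
- have := coxeter_eq_rel (x ++ z) (w ++ y) st; by rewrite -!catA.
- exact: coxeter_eq_refl.
- exact: coxeter_eq_sym.
- exact: coxeter_eq_trans st.
Qed.

Lemma coxeter_eq_cat s s' t t' :
  coxeter_eq s s' -> coxeter_eq t t' -> coxeter_eq (s ++ t) (s' ++ t').
Proof.
move=> ss' tt'; apply: (@coxeter_eq_trans _ (s' ++ t)).
  exact: (@coxeter_eq_ctx [::] t).
by have := coxeter_eq_ctx s' [::] tt'; rewrite !cats0.
Qed.

Lemma coxeter_eq_rev s t : coxeter_eq s t -> coxeter_eq (rev s) (rev t).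
Proof.
elim=> {s t} [x s t y st|s|s t _|s t v _ st _].
- rewrite !rev_cat -!catA; case: st => [i|i j ij|i k1] /=.
  + exact: (coxeter_eq_rel (rev y) (rev x) (coxeter_rel_sq i)).
  + exact/coxeter_eq_sym/(coxeter_eq_rel (rev y) (rev x) (coxeter_rel_comm ij)).
  + exact: (coxeter_eq_rel (rev y) (rev x) (coxeter_rel_braid i k1)).
- exact: coxeter_eq_refl.
- exact: coxeter_eq_sym.
- exact: coxeter_eq_trans st.
Qed.

Lemma coxeter_eq_revl s : coxeter_eq (rev s ++ s) [::].
Proof.
elim: s => [|i s IHs]; first exact: coxeter_eq_refl.
rewrite rev_cons cat_rcons.
apply: coxeter_eq_trans IHs.
exact: (@coxeter_eq_rel (rev s) [:: i; i] [::] s (coxeter_rel_sq i)).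
Qed.

Definition coxeter_eqb : rel (seq 'I_k.+1) := fun s t => `[< coxeter_eq s t >].

Lemma coxeter_eqb_equiv : equiv_class_of coxeter_eqb.
Proof.
split=> [s|s t|t s v].
- exact/asboolP/coxeter_eq_refl.
- by apply/asboolP/asboolP; apply: coxeter_eq_sym.
- by move=> /asboolP st /asboolP tv; apply/asboolP/(coxeter_eq_trans st).
Qed.
Canonical coxeter_eqb_equivrel := EquivRelPack coxeter_eqb_equiv.
Canonical coxeter_eqb_encmodrel := defaultEncModRel coxeter_eqb.

(* Since s_i ^ 2 = 1, words in the s_i (without inverses) modulo the relations
   already form the presented group.                                          *)
Definition affS := {eq_quot coxeter_eqb}.
HB.instance Definition _ : EqQuotient _ coxeter_eqb affS := EqQuotient.on affS.
HB.instance Definition _ := Choice.on affS.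

Lemma affS_eqP s t : reflect (coxeter_eq s t) (s == t %[mod affS]).
Proof. by rewrite piE; apply: asboolP. Qed.

Definition affS_one : affS := \pi_affS [::].
Definition affS_mul (v w : affS) : affS := \pi_affS (repr v ++ repr w).
Definition affS_inv (w : affS) : affS := \pi_affS (rev (repr w)).

Lemma affS_reprP s : coxeter_eq (repr (\pi_affS s)) s.
Proof. by apply/affS_eqP; rewrite reprK. Qed.

Lemma affS_mulE s t : affS_mul (\pi s) (\pi t) = \pi_affS (s ++ t).
Proof. by apply/eqP/affS_eqP/coxeter_eq_cat; apply: affS_reprP. Qed.

Lemma affS_invE s : affS_inv (\pi s) = \pi_affS (rev s).
Proof. by apply/eqP/affS_eqP/coxeter_eq_rev/affS_reprP. Qed.

Lemma affS_mulA : associative affS_mul.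
Proof.
by elim/quotW=> s; elim/quotW=> t; elim/quotW=> v; rewrite !affS_mulE catA.
Qed.

Lemma affS_mul1 : left_id affS_one affS_mul.
Proof. by elim/quotW=> s; rewrite affS_mulE. Qed.

Lemma affS_mulr1 : right_id affS_one affS_mul.
Proof. by elim/quotW=> s; rewrite affS_mulE cats0. Qed.

Lemma affS_mulV : left_inverse affS_one affS_inv affS_mul.
Proof.
elim/quotW=> s; rewrite affS_invE affS_mulE.
exact/eqP/affS_eqP/coxeter_eq_revl.
Qed.

Lemma affS_mulrV : right_inverse affS_one affS_inv affS_mul.
Proof.
elim/quotW=> s; rewrite affS_invE affS_mulE -{1}[s]revK.
exact/eqP/affS_eqP/coxeter_eq_revl.
Qed.

HB.instance Definition _ := isGroup.Build affS
  affS_mulA affS_mul1 affS_mulr1 affS_mulV affS_mulrV.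

Definition s_ i : affS := \pi_affS [:: i].
Definition s_word t : affS := (\prod_(i <- t) s_ i)%g.

Lemma s_wordE t : s_word t = \pi_affS t.
Proof.
elim: t => [|i t IHt]; rewrite /s_word ?big_nil // big_cons.
by rewrite [X in (_ * X)%g]IHt; apply: affS_mulE.
Qed.

Definition reduced t : Prop :=
  forall t', s_word t' = s_word t -> (size t <= size t')%N.

Definition reduced_word (w : affS) : seq 'I_k.+1 :=
  xget [::] [set t | s_word t = w /\ reduced t].

Lemma reduced_wordP w :
  s_word (reduced_word w) = w /\ reduced (reduced_word w).
Proof.
apply: (@xgetPex _ _ [set t | s_word t = w /\ reduced t]).
have exn : exists n, `[< exists2 t, s_word t = w & size t = n >].
  exists (size (repr w)); apply/asboolP.
  by exists (repr w); rewrite // s_wordE reprK.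
case: (ex_minnP exn) => n /asboolP[t tw tn] min_n.
exists t; split=> // t' t't; rewrite tn; apply: min_n.
by apply/asboolP; exists t'; rewrite // t't.
Qed.

Definition lengthS (w : affS) : nat := size (reduced_word w).

(* W_0 = <s_1, ..., s_k>; the s_i being involutions, products suffice.        *)
Definition in_W0 (v : affS) : Prop := exists2 t, ord0 \notin t & v = s_word t.

Definition in_minW0 (w : affS) : Prop :=
  forall v, in_W0 v -> (lengthS w <= lengthS (w * v)%g)%N.

End AffineSymmetricGroup.

(* Partitions are nonincreasing sequences of positive integers.  Rows and
   columns are numbered from 0, which does not affect contents or hooks.      *)
Definition is_part (la : seq nat) : bool := sorted geq la && (0%N \notin la).

Definition kbounded (k : nat) (la : seq nat) : bool :=
  is_part la && all (fun p => (p <= k)%N) la.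

Section Cores.
Local Open Scope nat_scope.
Variable k : nat.
Implicit Types (nu la : seq nat) (r c : nat).

Definition content r c : 'I_k.+1 := (inZp c - inZp r)%R.

Definition hook nu r c : nat :=
  (nth 0 nu r - c.+1) + (count (fun p => c < p) nu - r.+1) + 1.

Definition is_core nu : bool :=
  is_part nu && all (fun r => all (fun c => hook nu r c != k.+1)
                              (iota 0 (nth 0 nu r))) (iota 0 (size nu)).

(* The only box of row r that can be added (resp. removed) lies in column
   nth 0 nu r (resp. the preceding one).                                      *)
Definition addable (i : 'I_k.+1) nu r : bool :=
  ((r == 0) || (nth 0 nu r < nth 0 nu r.-1)) && (content r (nth 0 nu r) == i).

Definition removable (i : 'I_k.+1) nu r : bool :=
  (nth 0 nu r.+1 < nth 0 nu r) && (content r (nth 0 nu r).-1 == i).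

Definition s_act (i : 'I_k.+1) nu : seq nat :=
  let rows := iota 0 (size nu).+1 in
  let nonzero := filter (fun p => 0 < p) in
  if has (addable i nu) rows then
    nonzero [seq nth 0 nu r + addable i nu r | r <- rows]
  else if has (removable i nu) rows then
    nonzero [seq nth 0 nu r - removable i nu r | r <- rows]
  else nu.

(* On cores the result is the same for every word representing w.             *)
Definition act (w : affS k) nu : seq nat := foldr s_act nu (reduced_word w).

Definition bounded_of_core nu : seq nat :=
  [seq count (fun c => hook nu r c <= k) (iota 0 (nth 0 nu r))
     | r <- iota 0 (size nu)].

Definition core_of_bounded la : seq nat :=
  xget [::] [set nu | is_core nu /\ bounded_of_core nu = la].

Definition w_ la : affS k :=
  xget 1%g [set w | in_minW0 w /\ act w [::] = core_of_bounded la].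

End Cores.

Section NilCoxeterAlgebra.
Variables (K : comNzRingType) (k : nat).

Definition free_alg := {malg K[{fmonom 'I_k.+1}]}.
HB.instance Definition _ := GRing.Lalgebra.on free_alg.

Definition gen (i : 'I_k.+1) : free_alg := mkmalgU (fmu i) 1.

Inductive nilcoxeter_rel : free_alg -> Prop :=
| nilcoxeter_rel_sq i : nilcoxeter_rel (gen i * gen i)
| nilcoxeter_rel_comm i j : ~~ adjacent i j ->
    nilcoxeter_rel (gen i * gen j - gen j * gen i)
| nilcoxeter_rel_braid i : (1 < k)%N ->
    nilcoxeter_rel (gen i * gen (i + inZp 1) * gen i
                    - gen (i + inZp 1) * gen i * gen (i + inZp 1)).

Inductive nilcoxeter_ideal : free_alg -> Prop :=
| nilcoxeter_ideal_rel x : nilcoxeter_rel x -> nilcoxeter_ideal x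
| nilcoxeter_ideal0 : nilcoxeter_ideal 0
| nilcoxeter_idealD x y :
    nilcoxeter_ideal x -> nilcoxeter_ideal y -> nilcoxeter_ideal (x + y)
| nilcoxeter_idealM a x b :
    nilcoxeter_ideal x -> nilcoxeter_ideal (a * x * b).

Definition nilcoxeter_idealb : {pred free_alg} :=
  fun x => `[< nilcoxeter_ideal x >].

Lemma nilcoxeter_idealP x :
  reflect (nilcoxeter_ideal x) (x \in nilcoxeter_idealb).
Proof. exact: asboolP. Qed.

Lemma nilcoxeter_ideal_closed : zmod_closed nilcoxeter_idealb.
Proof.
split; first exact/nilcoxeter_idealP/nilcoxeter_ideal0.
move=> x y /nilcoxeter_idealP Ix /nilcoxeter_idealP Iy.
apply/nilcoxeter_idealP/nilcoxeter_idealD => //.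
by rewrite -[y]mulr1 -mulN1r mulrA; apply: nilcoxeter_idealM.
Qed.
HB.instance Definition _ :=
  GRing.isZmodClosed.Build free_alg nilcoxeter_idealb nilcoxeter_ideal_closed.

Lemma nilcoxeter_idealMl a x :
  x \in nilcoxeter_idealb -> a * x \in nilcoxeter_idealb.
Proof.
move=> /nilcoxeter_idealP Ix; rewrite -[a * x]mulr1.
exact/nilcoxeter_idealP/nilcoxeter_idealM.
Qed.

Lemma nilcoxeter_idealMr a x :
  x \in nilcoxeter_idealb -> x * a \in nilcoxeter_idealb.
Proof.
move=> /nilcoxeter_idealP Ix; rewrite -[x]mul1r.
exact/nilcoxeter_idealP/nilcoxeter_idealM.
Qed.

Lemma mcoeff1_gen i : mcoeff (@mone _) (gen i) = 0.
Proof.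
rewrite mcoeffU; case: eqP => // /(congr1 (@fdeg _)).
by rewrite fdegU fdeg1.
Qed.

Lemma nilcoxeter_ideal_mcoeff1 x :
  nilcoxeter_ideal x -> mcoeff (@mone _) x = 0.
Proof.
elim=> {x} [x [i|i j _|i _]||x y _ + _|a x b _].
- by rewrite rmorphM /= mcoeff1_gen mul0r.
- by rewrite rmorphB /= !rmorphM /= !mcoeff1_gen !mul0r subr0.
- by rewrite rmorphB /= !rmorphM /= !mcoeff1_gen !mul0r subr0.
- exact: rmorph0.
- by rewrite rmorphD /= => -> ->; rewrite addr0.
- by rewrite !rmorphM /= => ->; rewrite mulr0 mul0r.
Qed.

Lemma nilcoxeter_ideal1 : 1 \notin nilcoxeter_idealb.
Proof.
apply/negP => /nilcoxeter_idealP/nilcoxeter_ideal_mcoeff1.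
by rewrite rmorph1 => /eqP; rewrite oner_eq0.
Qed.

(* The quotient of the free algebra by the two-sided ideal generated by the
   relations; Quotient.quot only provides its additive structure.             *)
Definition nilcoxeter := Quotient.quot nilcoxeter_idealb.
HB.instance Definition _ := Choice.on nilcoxeter.
HB.instance Definition _ := ZmodQuotient.on nilcoxeter.

Lemma nilcoxeter_eqP (x y : free_alg) :
  reflect (nilcoxeter_ideal (x - y)) (x == y %[mod nilcoxeter]).
Proof. by rewrite -Quotient.idealrBE; apply: nilcoxeter_idealP. Qed.

Definition nilcoxeter_one : nilcoxeter := \pi_nilcoxeter (1 : free_alg).
Definition nilcoxeter_mul (x y : nilcoxeter) : nilcoxeter :=
  \pi_nilcoxeter (repr x * repr y).
Definition nilcoxeter_scale (a : K) (x : nilcoxeter) : nilcoxeter :=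
  \pi_nilcoxeter (a *: repr x).

Lemma nilcoxeter_reprP (x : free_alg) :
  repr (\pi_nilcoxeter x) - x \in nilcoxeter_idealb.
Proof. by rewrite Quotient.idealrBE reprK. Qed.

Lemma nilcoxeter_mulE x y :
  nilcoxeter_mul (\pi x) (\pi y) = \pi_nilcoxeter (x * y).
Proof.
apply/eqP; rewrite -Quotient.idealrBE.
set x' := repr _; set y' := repr _.
have -> : x' * y' - x * y = (x' - x) * y' + x * (y' - y).
  by rewrite mulrBl mulrBr addrA subrK.
by apply: rpredD; [apply: nilcoxeter_idealMr|apply: nilcoxeter_idealMl];
  apply: nilcoxeter_reprP.
Qed.

Lemma nilcoxeter_scaleE a x :
  nilcoxeter_scale a (\pi x) = \pi_nilcoxeter (a *: x).
Proof.
apply/eqP; rewrite -Quotient.idealrBE -scalerBr -mulr_algl.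
exact/nilcoxeter_idealMl/nilcoxeter_reprP.
Qed.

Lemma nilcoxeter_addE (x y : free_alg) :
  \pi_nilcoxeter x + \pi_nilcoxeter y = \pi_nilcoxeter (x + y).
Proof. by rewrite piE. Qed.

Lemma nilcoxeter_mulA : associative nilcoxeter_mul.
Proof.
elim/quotW=> x; elim/quotW=> y; elim/quotW=> z.
by rewrite !nilcoxeter_mulE mulrA.
Qed.

Lemma nilcoxeter_mul1 : left_id nilcoxeter_one nilcoxeter_mul.
Proof. by elim/quotW=> x; rewrite nilcoxeter_mulE mul1r. Qed.

Lemma nilcoxeter_mulr1 : right_id nilcoxeter_one nilcoxeter_mul.
Proof. by elim/quotW=> x; rewrite nilcoxeter_mulE mulr1. Qed.

Lemma nilcoxeter_mulDl : left_distributive nilcoxeter_mul +%R.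
Proof.
elim/quotW=> x; elim/quotW=> y; elim/quotW=> z.
by rewrite nilcoxeter_addE !nilcoxeter_mulE nilcoxeter_addE mulrDl.
Qed.

Lemma nilcoxeter_mulDr : right_distributive nilcoxeter_mul +%R.
Proof.
elim/quotW=> x; elim/quotW=> y; elim/quotW=> z.
by rewrite nilcoxeter_addE !nilcoxeter_mulE nilcoxeter_addE mulrDr.
Qed.

Lemma nilcoxeter_one_neq0 : nilcoxeter_one != 0.
Proof.
have -> : 0 = \pi_nilcoxeter (0 : free_alg) by rewrite piE.
by rewrite -Quotient.idealrBE subr0; apply: nilcoxeter_ideal1.
Qed.

HB.instance Definition _ := GRing.Zmodule_isNzRing.Build nilcoxeter
  nilcoxeter_mulA nilcoxeter_mul1 nilcoxeter_mulr1
  nilcoxeter_mulDl nilcoxeter_mulDr nilcoxeter_one_neq0.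

Lemma nilcoxeter_scaleA a b x :
  nilcoxeter_scale a (nilcoxeter_scale b x) = nilcoxeter_scale (a * b) x.
Proof. by elim/quotW: x => x; rewrite !nilcoxeter_scaleE scalerA. Qed.

Lemma nilcoxeter_scale1 : left_id 1 nilcoxeter_scale.
Proof. by elim/quotW=> x; rewrite nilcoxeter_scaleE scale1r. Qed.

Lemma nilcoxeter_scaleDr : right_distributive nilcoxeter_scale +%R.
Proof.
move=> a; elim/quotW=> x; elim/quotW=> y.
by rewrite nilcoxeter_addE !nilcoxeter_scaleE nilcoxeter_addE scalerDr.
Qed.

Lemma nilcoxeter_scaleDl x :
  {morph nilcoxeter_scale^~ x : a b / a + b >-> a + b}.
Proof.
elim/quotW: x => x a b.
by rewrite !nilcoxeter_scaleE nilcoxeter_addE scalerDl.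
Qed.

HB.instance Definition _ := GRing.Zmodule_isLmodule.Build K nilcoxeter
  nilcoxeter_scaleA nilcoxeter_scale1 nilcoxeter_scaleDr nilcoxeter_scaleDl.

Lemma nilcoxeter_scaleAl (a : K) (x y : nilcoxeter) :
  a *: (x * y) = a *: x * y.
Proof.
elim/quotW: x => x; elim/quotW: y => y.
change (nilcoxeter_scale a (nilcoxeter_mul (\pi x) (\pi y)) =
        nilcoxeter_mul (nilcoxeter_scale a (\pi x)) (\pi y)).
by rewrite nilcoxeter_mulE !nilcoxeter_scaleE nilcoxeter_mulE scalerAl.
Qed.

HB.instance Definition _ :=
  GRing.Lmodule_isLalgebra.Build K nilcoxeter nilcoxeter_scaleAl.

Lemma free_alg_scaleAr (a : K) (x y : free_alg) : a *: (x * y) = x * (a *: y).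
Proof.
apply/malgP=> m; rewrite mcoeffZ.
rewrite [in RHS](mcoeffMlw m (finmap.fsubset_refl _) (msuppZ_le _ _)).
rewrite mcoeffMl mulr_sumr; apply: eq_bigr => m1 _.
rewrite mulr_sumr; apply: eq_bigr => m2 _.
by rewrite mcoeffZ mulrnAr mulrCA.
Qed.

Lemma nilcoxeter_scaleAr (a : K) (x y : nilcoxeter) :
  a *: (x * y) = x * (a *: y).
Proof.
elim/quotW: x => x; elim/quotW: y => y.
change (nilcoxeter_scale a (nilcoxeter_mul (\pi x) (\pi y)) =
        nilcoxeter_mul (\pi x) (nilcoxeter_scale a (\pi y))).
by rewrite nilcoxeter_mulE !nilcoxeter_scaleE nilcoxeter_mulE free_alg_scaleAr.
Qed.

HB.instance Definition _ :=
  GRing.Lalgebra_isAlgebra.Build K nilcoxeter nilcoxeter_scaleAr.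

Definition u_ (i : 'I_k.+1) : nilcoxeter := \pi_nilcoxeter (gen i).

Definition u_word (t : seq 'I_k.+1) : nilcoxeter := \prod_(i <- t) u_ i.

(* u(w); it does not depend on the reduced word chosen for w.                 *)
Definition u_of (w : affS k) : nilcoxeter := u_word (reduced_word w).

Definition u_part (la : seq nat) : nilcoxeter := u_of (w_ k la).

(* A word for u_D, see decreasing_wordP: D is read in the cyclic order
   a - 1, a - 2, ..., a - k, where a is some element not in D.                *)
Definition decreasing_word (D : {set 'I_k.+1}) : seq 'I_k.+1 :=
  if [pick a | a \notin D] is Some a then
    [seq j <- [seq a - inZp m | m <- iota 1 k] | j \in D]
  else [::].

Lemma decreasing_wordP (D : {set 'I_k.+1}) : D \proper [set: 'I_k.+1] ->
  [/\ uniq (decreasing_word D), decreasing_word D =i D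
    & forall j, j \in D -> j + inZp 1 \in D ->
      (index (j + inZp 1)%R (decreasing_word D) <
         index j (decreasing_word D))%N].
Proof.
move=> /properP[_ [b _ bD]]; rewrite /decreasing_word.
case: pickP => [a aD|/(_ b)]; last by rewrite bD.
set L := [seq a - inZp m | m <- iota 1 k].
have valL m : m \in iota 1 k -> a - (a - inZp m) = m :> nat.
  by rewrite mem_iota add1n => /andP[_ mk]; rewrite subKr /= modn_small.
pose r (x y : 'I_k.+1) := (val (a - x)%R < val (a - y)%R)%N.
have r_trans : transitive r by move=> y x z; apply: ltn_trans.
have rL : sorted r L.
  rewrite sorted_map; apply: (@sub_in_sorted _ (mem (iota 1 k)) ltn).
  - by move=> m n mk nk; rewrite -{1}(valL m mk) -{1}(valL n nk).
  - exact/allP.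
  - exact: iota_ltn_sorted.
have memL j : j \in D -> j \in L /\ (0 < val (a - j)%R)%N.
  move=> jD; have aj : (0 < val (a - j)%R)%N.
    rewrite lt0n; apply: contraNneq aD => aj.
    by suff -> : a = j by []; apply/eqP; rewrite -subr_eq0; apply/eqP/val_inj.
  split=> //; apply/mapP; exists (val (a - j)%R); last by rewrite valZpK subKr.
  by rewrite mem_iota aj add1n ltn_ord.
split=> [|j|j jD j1D].
- by rewrite filter_uniq // (sorted_uniq r_trans) // => x; rewrite /r ltnn.
- by rewrite mem_filter; case: (boolP (j \in D)) => // /memL[->].
have [_ aj] := memL _ jD.
have rj : r (j + inZp 1) j.
  rewrite /r opprD addrA -[a - j]valZpK.
  have inZpB m : (0 < m)%N -> inZp m - inZp 1 = inZp m.-1 :> 'I_k.+1.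
    case: m => // m _; apply/eqP; rewrite subr_eq; apply/eqP/val_inj => /=.
    by rewrite modnDml modnDmr addn1.
  rewrite inZpB //.
  move: aj; case: (a - j) => [[|m] mk] //= _.
  by rewrite !modn_small // ltnW.
rewrite ltnNge leq_eqVlt; apply/negP => /orP[/eqP ij|].
  have jE : j = j + inZp 1.
    rewrite -[LHS](@nth_index _ 0 _ [seq x <- L | x \in D]) ?ij ?nth_index //.
    - by rewrite mem_filter j1D; case: (memL _ j1D).
    - by rewrite mem_filter jD; case: (memL _ jD).
  by move: rj; rewrite -jE /r ltnn.
have inL x : x \in D -> x \in [seq x <- L | x \in D].
  by move=> xD; rewrite mem_filter xD; case: (memL _ xD).
have sL := sorted_filter r_trans (mem D) rL.
move=> /(sorted_ltn_index r_trans sL _ _ (inL _ jD) (inL _ j1D)).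
by rewrite /r ltnNge ltnW.
Qed.

Definition u_set (D : {set 'I_k.+1}) : nilcoxeter := u_word (decreasing_word D).

Definition h_ (i : nat) : nilcoxeter :=
  \sum_(D : {set 'I_k.+1} | (D \proper [set: 'I_k.+1]) && (#|D| == i)) u_set D.

Definition in_h_subalg (x : nilcoxeter) : Prop :=
  forall S : {pred nilcoxeter}, GRing.subalg_closed S ->
    (forall i, (1 <= i <= k)%N -> h_ i \in S) -> x \in S.

Definition pieri_set (i : nat) (la : seq nat) : set (seq nat) :=
  [set mu | kbounded k mu /\
     exists D : {set 'I_k.+1},
       [/\ D \proper [set: 'I_k.+1], #|D| = i
         & u_part mu = u_set D * u_part la]].

(* [s la] is the k-Schur function of la when la is k-bounded; the values of [s]
   on other sequences are unconstrained.  The sum is finite, since u_mu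
   determines mu, hence each D contributes at most one mu.                    *)
Definition is_kSchur (s : seq nat -> nilcoxeter) : Prop :=
  [/\ forall la, kbounded k la -> in_h_subalg (s la),
      s [::] = 1
    & forall i la, (1 <= i <= k)%N -> kbounded k la ->
        h_ i * s la = \sum_(mu \in pieri_set i la) s mu].

End NilCoxeterAlgebra.

(* Main.v *)
(* The algebra acts on the right on the functions of a state f : Z/(k+1) -> Z
   (see [swap]): u_i precomposes with the exchange of f(i) and f(i+1), up to a
   shift by 1, when f(i+1) <= f(i), and is zero otherwise.  The states reached
   from 0 form the regular representation; those reached from [grass0] are the
   cosets W/W_0, that is, the (k+1)-cores, f(i) being the least integer of
   residue i which is not a bead lambda_r - r.  The second module is already
   faithful, because a reduced path starting at 0 can be moved into an orbit
   point deep inside a chamber.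

   The Pieri rule determines the s_lambda: by induction, s_lambda sends the empty
   core to the core of lambda.  Let P raise all values f(i) by c, move them
   from residue i to residue i + c, and then lower the c smallest values by
   k + 1.  Then P u_i = u_{i+c} P, so P commutes with every h_j, and P maps the
   empty core to R.  As the h_j commute with each other, for b in their
   subalgebra s_R (b 0) = b (s_R 0) = b (P 0) = P (b 0), where 0 is the empty
   core.  Thus s_R acts as P on a faithful module, hence
   s_R u_i = u_{i+c} s_R. *)
Require Import Defs.
From mathcomp Require Import finmap boolp classical_sets functions.
From mathcomp Require Import fsbigop.
From mathcomp.multinomials Require Import monalg.
From mathcomp Require Import all_boot all_order all_algebra perm.
From mathcomp Require Import zify.

Set Implicit Arguments.
Unset Strict Implicit.
Unset Printing Implicit Defensive.

Import Order.TTheory GRing.Theory Num.Theory.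
Local Open Scope ring_scope.
Local Open Scope quotient_scope.

(** * States and words *)

(** Functions on states replace formal combinations of states: precomposition lets the algebra act
    with no linear structure on the orbit, at the price of a right action, and an indicator function
    reads off a single coefficient. The facts usually quoted (the h_j commute, minimal coset
    representatives are the ascending paths, bounded partitions correspond to cores) are all derived
    from this model and the Pieri rule in [is_kSchur]. The shape of P is forced. Moving values from
    residue i to residue i + c and adding c keeps f(i) congruent to i modulo k + 1, but raises the
    sum of the values by c(k + 1), so the result leaves the orbit; lowering c values by k + 1
    restores the sum. Choosing the smallest ones is compatible with ascending swaps because the
    values of a state in the orbit are pairwise incongruent, so a change by 1 never lets a value
    pass a third one. *)

Section States.
Variable k : nat.
Hypothesis hk : (0 < k)%N.
Local Notation I := 'I_k.+1.
Implicit Types (i j l : I) (t : seq I).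

Definition nx i : I := i + inZp 1.

Lemma nx_inj : injective nx.
Proof. exact: addIr. Qed.

Lemma one_neq0 : inZp 1 != 0 :> I.
Proof. by rewrite -val_eqE /= modn_small. Qed.

Lemma nx_neq i : (nx i == i) = false.
Proof. by rewrite /nx -[X in _ == X]addr0 (inj_eq (addrI _)) (negbTE one_neq0). Qed.

Lemma neq_nx i : (i == nx i) = false.
Proof. by rewrite eq_sym nx_neq. Qed.

Lemma nx2_neq i : (1 < k)%N -> (nx (nx i) == i) = false.
Proof.
move=> k1; rewrite /nx -addrA -[X in _ == X]addr0 (inj_eq (addrI _)) -val_eqE /=.
by rewrite !modnDml modnDmr modn_small.
Qed.

Lemma adjacentE i j : adjacent i j = (i == nx j) || (j == nx i).
Proof. by rewrite /adjacent !subr_eq ![inZp 1 + _]addrC. Qed.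

Lemma neq_nx_k1 i j : k = 1%N -> i != j -> j = nx i.
Proof.
move=> k1; rewrite -val_eqE => /= ij; apply/val_inj => /=.
move: (ltn_ord i) (ltn_ord j) ij; move: (i : nat) (j : nat) => {}i {}j.
by rewrite k1; case: i => [|[|]] // _; case: j => [|[|]].
Qed.

Definition state := {ffun I -> int}.
Implicit Types f g : state.

(* A map p : Z -> Z with p (x + k + 1) = p x + 1 is encoded by the periodic
   function f x = x - (k + 1) * p x; composing p with s_i becomes [swap i]. *)
Definition swap i f : state :=
  [ffun j => if j == i then f (nx i) - 1 else if j == nx i then f i + 1 else f j].

(** One of three cases. If [f (nx i) = f i + 1] the swap fixes [f]; if [f (nx i) >= f i + 2] it
    undoes an ascent. *)
Definition ascent i f := f (nx i) <= f i.

Lemma swap_l i f : swap i f i = f (nx i) - 1.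
Proof. by rewrite ffunE eqxx. Qed.

Lemma swap_r i f : swap i f (nx i) = f i + 1.
Proof. by rewrite ffunE nx_neq eqxx. Qed.

Lemma swap_out i j f : j != i -> j != nx i -> swap i f j = f j.
Proof. by move=> /negbTE ji /negbTE jni; rewrite ffunE ji jni. Qed.

Lemma swapK i : involutive (swap i).
Proof.
move=> f; apply/ffunP=> j; rewrite ffunE.
case: eqVneq => [->|ji]; first by rewrite swap_r addrK.
case: eqVneq => [->|jn]; first by rewrite swap_l subrK.
by rewrite swap_out.
Qed.

Lemma swap_fix i f : f (nx i) = f i + 1 -> swap i f = f.
Proof.
move=> fi; apply/ffunP=> j; rewrite ffunE.
by do 2?case: eqVneq => [->|_] //; rewrite fi ?addrK.
Qed.

Lemma swap_comm i j f : ~~ adjacent i j -> swap i (swap j f) = swap j (swap i f).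
Proof.
rewrite adjacentE negb_or => /andP[/negbTE inj /negbTE jni].
case: (eqVneq i j) => [-> //|/negbTE ij].
have ji : (j == i) = false by rewrite eq_sym.
have nij : (nx i == nx j) = false by rewrite (inj_eq nx_inj).
have nji : (nx j == nx i) = false by rewrite (inj_eq nx_inj).
have nij' : (nx i == j) = false by rewrite eq_sym.
have nji' : (nx j == i) = false by rewrite eq_sym.
apply/ffunP=> x; rewrite !ffunE.
rewrite ?(inj_eq nx_inj) ?ij ?ji ?inj ?jni ?nij ?nji ?nij' ?nji' ?eqxx.
case: (eqVneq x i) => [->|xi]; first by rewrite ij inj.
case: (eqVneq x (nx i)) => [->|xni]; first by rewrite nij' nij.
by [].
Qed.

Lemma swap_braid i f : (1 < k)%N ->
  swap i (swap (nx i) (swap i f)) = swap (nx i) (swap i (swap (nx i) f)).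
Proof.
move=> k1.
have E := (nx_neq, neq_nx, nx2_neq i k1).
have E' : (i == nx (nx i)) = false by rewrite eq_sym nx2_neq.
have E2 : (nx (nx i) == nx i) = false by rewrite nx_neq.
have E3 : (nx i == nx (nx i)) = false by rewrite neq_nx.
apply/ffunP=> x; rewrite !ffunE !(E, E', E2, E3, eqxx).
case: (eqVneq x i) => [->|xi]; first by rewrite ?(E, E', E2, E3, eqxx); lia.
case: (eqVneq x (nx i)) => [_|xni]; first by lia.
by case: eqVneq => [_|xn2]; lia.
Qed.

Fixpoint walk t f := if t is i :: t1 then swap i (walk t1 f) else f.

Fixpoint ascending t f :=
  if t is i :: t1 then ascending t1 f && ascent i (walk t1 f) else true.

Lemma walk_cat s t f : walk (s ++ t) f = walk s (walk t f).
Proof. by elim: s => [|i s IHs] //=; rewrite IHs. Qed.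

Lemma ascending_cat s t f : ascending (s ++ t) f = ascending t f &&
  ascending s (walk t f).
Proof. by elim: s => [|i s IHs] /=; rewrite ?andbT // IHs walk_cat andbA. Qed.

Lemma walk_revK t : cancel (walk t) (walk (rev t)).
Proof.
elim: t => [|i t IHt] f //=.
by rewrite rev_cons -cats1 walk_cat /= swapK IHt.
Qed.

Lemma walk_coxeter s t f : coxeter_eq s t -> walk s f = walk t f.
Proof.
move=> st; elim: st f => {s t} [x s t y st|s|s t _ IH|s t x _ IH1 _ IH2] f //.
- rewrite !walk_cat; congr (walk x _).
  case: st => [i|i j ij|i k1] /=; first by rewrite swapK.
    by rewrite swap_comm.
  exact: swap_braid.
- by rewrite IH1 IH2.
Qed.

Lemma s_word_coxeter s t : s_word s = s_word t -> coxeter_eq s t.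
Proof. by rewrite !s_wordE => /eqP/affS_eqP. Qed.

Lemma coxeter_s_word s t : coxeter_eq s t -> s_word s = s_word t.
Proof. by move=> st; rewrite !s_wordE; apply/eqP/affS_eqP. Qed.

Lemma walk_s_word s t f : s_word s = s_word t -> walk s f = walk t f.
Proof. by move/s_word_coxeter/walk_coxeter. Qed.

Lemma s_word_cat s t : s_word (s ++ t) = (s_word s * s_word t)%g.
Proof. exact: big_cat. Qed.

Lemma s_word_rev t : s_word (rev t) = (s_word t)^-1%g.
Proof. by rewrite !s_wordE; apply/esym/affS_invE. Qed.

Lemma s_word_ctx x y s t :
  s_word s = s_word t -> s_word (x ++ s ++ y) = s_word (x ++ t ++ y).
Proof. by rewrite !s_word_cat => ->. Qed.

Lemma s_word_sq i t : s_word (i :: i :: t) = s_word t.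
Proof.
exact/coxeter_s_word/(@coxeter_eq_rel _ [::] _ _ t (coxeter_rel_sq i)).
Qed.

Lemma s_word_comm i j t : ~~ adjacent i j ->
  s_word (i :: j :: t) = s_word (j :: i :: t).
Proof.
move=> ij.
exact/coxeter_s_word/(@coxeter_eq_rel _ [::] _ _ t (coxeter_rel_comm ij)).
Qed.

Lemma s_word_braid i t : (1 < k)%N ->
  s_word [:: i, nx i, i & t] = s_word [:: nx i, i, nx i & t].
Proof.
move=> k1.
exact/coxeter_s_word/(@coxeter_eq_rel _ [::] _ _ t (coxeter_rel_braid i k1)).
Qed.

End States.

(** * The action of the nilCoxeter algebra *)

Section Action.
Variables (K : comNzRingType) (k : nat).
Hypothesis hk : (0 < k)%N.
Local Notation I := 'I_k.+1.
Local Notation A := (nilcoxeter K k).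
Implicit Types (i j l : I) (t : seq I) (f g : state k) (v : state k -> K).

Lemma nc_piM (x y : free_alg K k) : \pi_A x * \pi_A y = \pi_A (x * y).
Proof. exact: nilcoxeter_mulE. Qed.

Lemma nc_pi_eq (x y : free_alg K k) : nilcoxeter_ideal (x - y) -> \pi_A x = \pi_A y.
Proof. by move=> xy; apply/eqP/nilcoxeter_eqP. Qed.

Lemma u_sq i : u_ K i * u_ K i = 0.
Proof.
have -> : 0 = \pi_A (0 : free_alg K k) by rewrite piE.
rewrite /u_ nc_piM; apply: nc_pi_eq; rewrite subr0.
exact/nilcoxeter_ideal_rel/nilcoxeter_rel_sq.
Qed.

Lemma u_comm i j : ~~ adjacent i j -> u_ K i * u_ K j = u_ K j * u_ K i.
Proof.
move=> ij; rewrite /u_ !nc_piM; apply: nc_pi_eq.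
exact/nilcoxeter_ideal_rel/nilcoxeter_rel_comm.
Qed.

Lemma nc_piM3 (x y z : free_alg K k) : \pi_A x * \pi_A y * \pi_A z = \pi_A (x * y
  * z).
Proof. by rewrite !nc_piM. Qed.

Lemma u_braid i : (1 < k)%N ->
  u_ K i * u_ K (nx i) * u_ K i = u_ K (nx i) * u_ K i * u_ K (nx i).
Proof.
move=> k1; apply: (etrans (nc_piM3 _ _ _));
  apply: (etrans _ (esym (nc_piM3 _ _ _))).
apply: nc_pi_eq.
exact/nilcoxeter_ideal_rel/nilcoxeter_rel_braid.
Qed.

Lemma u_word_cons i t : u_word K (i :: t) = u_ K i * u_word K t.
Proof. exact: big_cons. Qed.

Lemma u_word_cat s t : u_word K (s ++ t) = u_word K s * u_word K t.
Proof. exact: big_cat. Qed.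

(** Words act on states from the left, hence on functions from the right; the value 0 records a path
    that fails to ascend. [V] is left open because the functions in [pieri] take values in the
    algebra itself. *)
Definition walk_val (V : nmodType) t (v : state k -> V) f : V :=
  if ascending t f then v (walk t f) else 0.

Lemma walk_val_cat (V : nmodType) s t (v : state k ->
  V) f : walk_val (s ++ t) v f = walk_val t (walk_val s v) f.
Proof. by rewrite /walk_val ascending_cat walk_cat; case: (ascending t f). Qed.

Definition free_act v (x : free_alg K k) f : K :=
  mmap idfun (fun m : {fmonom I} => walk_val m v f) x.

Lemma free_actD v x y f : free_act v (x + y) f = free_act v x f + free_act v y f.
Proof. exact: mmapD. Qed.
Lemma free_actB v x y f : free_act v (x - y) f = free_act v x f - free_act v y f.
Proof. exact: mmapB. Qed.

Lemma free_actZ v a x f : free_act v (a *: x) f = a * free_act v x f.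
Proof.
rewrite /free_act (mmapEw (msuppZ_le _ _)) mmapE mulr_sumr.
by apply: eq_bigr => m _ /=; rewrite mcoeffZ mulrA.
Qed.

Lemma free_actU v c (m : {fmonom I}) f : free_act v (mkmalgU m c) f = c *
  walk_val m v f.
Proof. exact: mmapU. Qed.

Lemma free_actE v x f : free_act v x f = \sum_(m <- msupp x) mcoeff m x *
  walk_val m v f.
Proof. by []. Qed.

Lemma free_actM v x y f : free_act v (x * y) f = free_act (free_act v x) y f.
Proof.
transitivity (\sum_(m' <- msupp x) \sum_(m <- msupp y)
    mcoeff m' x * mcoeff m y * walk_val m (walk_val m' v) f).
  rewrite malgME /free_act raddf_sum; apply: eq_bigr => m' _.
  by rewrite raddf_sum; apply: eq_bigr => m _; rewrite /= mmapU /= fmM walk_val_cat.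
rewrite exchange_big free_actE; apply: eq_bigr => m _.
case: (boolP (ascending m f)) => mf; last first.
  rewrite [walk_val m _ f]/walk_val (negbTE mf) mulr0 big1 // => m' _.
  by rewrite /walk_val (negbTE mf) mulr0.
rewrite [walk_val m _ f]/walk_val mf free_actE mulr_sumr; apply: eq_bigr => m' _.
by rewrite [in LHS]/walk_val mf mulrCA mulrA.
Qed.

Lemma rac0 f x : free_act (fun=> 0) x f = 0.
Proof. by rewrite free_actE big1 // => m _; rewrite /walk_val if_same mulr0. Qed.

Lemma free_act_gen v i f : free_act v (gen K i) f = walk_val [:: i] v f.
Proof. by rewrite free_actU fmU mul1r. Qed.

Lemma free_act_gens v i : free_act v (gen K i) = walk_val [:: i] v.
Proof. by apply/funext => f; rewrite free_act_gen. Qed.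

Lemma ascent_swap i f : ascent i f -> ascent i (swap i f) = false.
Proof. by rewrite /ascent swap_l (swap_r hk); lia. Qed.

Lemma walk_val_eq (V : nmodType) s t (v : state k ->
  V) f : ascending s f = ascending t f -> walk s f = walk t f ->
  walk_val s v f = walk_val t v f.
Proof. by rewrite /walk_val => -> ->. Qed.


Lemma free_actB0 v x y f : free_act v x f = free_act v y f ->
  free_act v (x - y) f = 0.
Proof. by move=> xy; rewrite free_actB xy subrr. Qed.

Lemma free_act_gen2 v i j f : free_act v (gen K i * gen K j) f = walk_val [:: i;
  j] v f.
Proof. by rewrite free_actM !free_act_gens -walk_val_cat. Qed.

Lemma free_act_gen3 v i j l f :
  free_act v (gen K i * gen K j * gen K l) f = walk_val [:: i; j; l] v f.
Proof.
rewrite free_actM free_act_gen -[RHS]/(walk_val ([:: i;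
  j] ++ [:: l]) v f) walk_val_cat /walk_val.
by case: ifP => // _; rewrite free_act_gen2.
Qed.

(** A swap after an ascent at the same letter is no ascent, which kills the squares; distinct
    non-adjacent letters involve disjoint values; both sides of a braid relation ascend exactly when
    f(i + 2) <= f(i + 1) <= f(i). *)
Lemma nil_rel_free_act x : nilcoxeter_rel x -> forall v f, free_act v x f = 0.
Proof.
case=> [i|i j ij|i k1] v f.
- rewrite free_act_gen2 /walk_val /=.
  by case: ifP => // /andP[fi]; rewrite ascent_swap.
- apply/free_actB0/(etrans (free_act_gen2 _ _ _ _))/(etrans _ (esym
  (free_act_gen2 _ _ _ _))).
  apply: walk_val_eq => /=; last exact: swap_comm.
  move: ij; rewrite adjacentE negb_or => /andP[inj jni].
  case: (eqVneq i j) => [->//|ij].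
  have [nij nij'] : nx i != nx j /\ nx j != nx i.
    by rewrite !(inj_eq (@nx_inj _)) [j == i]eq_sym ij.
  by rewrite /ascent !swap_out ?[nx i == j]eq_sym ?[nx j == i]eq_sym ?[j ==
    i]eq_sym //
    andbC.
- apply/free_actB0/(etrans (free_act_gen3 _ _ _ _ _))/(etrans _ (esym
  (free_act_gen3 _ _ _ _ _))).
  apply: walk_val_eq => /=; last exact: swap_braid.
  rewrite /ascent -/(nx i).
  rewrite !ffunE !(nx_neq, neq_nx, nx2_neq, eqxx) //.
  have -> : (i == nx (nx i)) = false by rewrite eq_sym nx2_neq.
  lia.
Qed.

Lemma nil_ideal_free_act x : nilcoxeter_ideal x -> forall v f, free_act v x f = 0.
Proof.
elim=> {x} [x /nil_rel_free_act //||x y _ IHx _ IHy|a x b _ IH] v f.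
- by rewrite free_actE msupp0 big_seq_fset0.
- by rewrite free_actD IHx IHy addr0.
- rewrite free_actM (_ : free_act v (a * x) = fun=> 0) ?rac0 //.
  by apply/funext => g; rewrite free_actM IH.
Qed.

Definition nil_act v (x : A) f := free_act v (repr x) f.

Lemma nil_actE v (x : free_alg K k) f : nil_act v (\pi x) f = free_act v x f.
Proof.
apply/eqP; rewrite /nil_act -subr_eq0 -free_actB.
by apply/eqP/nil_ideal_free_act; apply/nilcoxeter_idealP/nilcoxeter_reprP.
Qed.

Lemma nil_actD v x y f : nil_act v (x + y) f = nil_act v x f + nil_act v y f.
Proof.
elim/quotW: x => x; elim/quotW: y => y.
by rewrite nilcoxeter_addE !nil_actE free_actD.
Qed.

Lemma nact0 v f : nil_act v 0 f = 0.
Proof. by apply: (@addrI _ (nil_act v 0 f)); rewrite -nil_actD !addr0. Qed.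

Lemma nil_actM v x y f : nil_act v (x * y) f = nil_act (nil_act v x) y f.
Proof.
elim/quotW: x => x; elim/quotW: y => y.
rewrite nc_piM !nil_actE free_actM.
by congr free_act; apply/funext => g; rewrite nil_actE.
Qed.

Lemma nil_actZ v a x f : nil_act v (a *: x) f = a * nil_act v x f.
Proof.
elim/quotW: x => x.
rewrite (_ : a *: _ = \pi_A (a *: x)); last exact: nilcoxeter_scaleE.
by rewrite !nil_actE free_actZ.
Qed.

Lemma nil_actB v x y f : nil_act v (x - y) f = nil_act v x f - nil_act v y f.
Proof. by rewrite -scaleN1r nil_actD nil_actZ mulN1r. Qed.

Lemma nil_act_sum v (J : Type) (r : seq J) (P : pred J) (F : J -> A) f :
  nil_act v (\sum_(j <- r | P j) F j) f = \sum_(j <- r | P j) nil_act v (F j) f.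
Proof.
by apply: (big_morph (fun x => nil_act v x f)) => [x y|];
  [apply: nil_actD|apply: nact0].
Qed.

Lemma nact1 v f : nil_act v 1 f = v f.
Proof. by rewrite nil_actE free_actU mul1r fm1. Qed.

Lemma nil_act_u v i f : nil_act v (u_ K i) f = if ascent i f then v (swap i f)
  else 0.
Proof. by rewrite nil_actE free_act_gen. Qed.

Lemma nil_act_word v t f : nil_act v (u_word K t) f = walk_val t v f.
Proof.
elim: t v f => [|i t IHt] v f; first by rewrite /u_word big_nil nact1.
rewrite u_word_cons nil_actM IHt /walk_val /=; case: (ascending t f) => //=.
by rewrite nil_act_u.
Qed.

End Action.

(** * Ascending paths *)

Lemma mulr_comm (R : pzRingType) (a b x : R) :
  a * b = b * a -> a * (b * x) = b * (a * x).
Proof. by move=> e; rewrite !mulrA e. Qed.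

Lemma mulr_braid (R : pzRingType) (a b x : R) :
  a * b * a = b * a * b -> a * (b * (a * x)) = b * (a * (b * x)).
Proof. by move=> e; rewrite !mulrA e. Qed.

Section Words.
Variables (K : comNzRingType) (k : nat).
Hypothesis hk : (0 < k)%N.
Local Notation I := 'I_k.+1.
Implicit Types (i j l : I) (s t : seq I) (f g : state k).

(** Replaces equivalence under commutation and braid moves by four invariants of these moves. The
    set of letters is what later recovers [D] from a path. *)
Definition braid_eq s t : Prop :=
  [/\ u_word K s = u_word K t, s_word s = s_word t, size s = size t & s =i t].

Lemma braid_eq_sym s t : braid_eq s t -> braid_eq t s.
Proof. by case=> ? ? ? st; split=> // x; rewrite st. Qed.

Lemma braid_eq_trans s t x : braid_eq s t -> braid_eq t x -> braid_eq s x.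
Proof.
case=> e1 e2 e3 e4 [f1 f2 f3 f4].
by split=> [| | |y]; rewrite ?(e1, e2, e3) ?e4.
Qed.

Lemma braid_eq_cons i s t : braid_eq s t -> braid_eq (i :: s) (i :: t).
Proof.
case=> e1 e2 e3 e4; split=> [| | |x]; first by rewrite u_word_cons e1 -u_word_cons.
- by have := s_word_ctx [:: i] [::] e2; rewrite !cats0.
- by rewrite /= e3.
- by rewrite !inE e4.
Qed.

Lemma braid_eq_comm i j t : ~~ adjacent i j -> braid_eq [:: i, j & t] [:: j, i & t].
Proof.
move=> ij; split=> // [| |x]; last by rewrite !inE orbCA.
  by rewrite !u_word_cons; apply/mulr_comm/u_comm.
exact: s_word_comm.
Qed.

Lemma braid_eq_braid i t : (1 < k)%N ->
  braid_eq [:: i, nx i, i & t] [:: nx i, i, nx i & t].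
Proof.
move=> k1; split=> // [| |x]; last first.
    by rewrite !inE; case: (x == i); case: (x == nx i).
  exact: s_word_braid.
by rewrite !u_word_cons; apply/mulr_braid/u_braid.
Qed.

(** The ascent condition depends only on the product in the algebra, which sends the constant
    function 1 to the indicator of the states from which the word ascends. *)
Lemma braid_eq_act s t f : braid_eq s t ->
  ascending s f = ascending t f /\ walk s f = walk t f.
Proof.
case=> st /walk_s_word -> // _ _; split=> //.
have := nil_act_word hk (fun=> 1 : K) s f; rewrite st nil_act_word // /walk_val.
by do 2!case: ifP => // _; move/eqP; rewrite ?oner_eq0 // eq_sym oner_eq0.
Qed.

(** At such a state every swap is an ascent or trivial. Both base states are of this kind; it makes
    the ascending paths from them minimal representatives modulo the stabilizer. *)
Definition no_descent f := forall i, f (nx i) <= f i + 1.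


Lemma nx2K : k = 1%N -> involutive (@nx k).
Proof. by move=> k1 i; rewrite -(neq_nx_k1 k1 (negbT (nx_neq hk i))). Qed.

Lemma adjacentP i j : i != j -> adjacent i j ->
  [\/ k = 1%N /\ j = nx i, (1 < k)%N /\ j = nx i | (1 < k)%N /\ i = nx j].
Proof.
move=> ij; have [k1|k1] := ltnP 1 k; last first.
  by move=> _; apply/Or31; have k1' : k = 1%N by [lia]; rewrite (neq_nx_k1 k1' ij).
by rewrite adjacentE => /orP[] /eqP ->; [apply/Or33|apply/Or32].
Qed.

Lemma swap_nx2 i f : (1 < k)%N -> swap i f (nx (nx i)) = f (nx (nx i)).
Proof. by move=> k1; rewrite swap_out ?nx2_neq // nx_neq. Qed.

Lemma swap_prev i f : (1 < k)%N -> swap (nx i) f i = f i.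
Proof. by move=> k1; rewrite swap_out ?neq_nx // eq_sym nx2_neq. Qed.

Lemma swap_far i j f : j != i -> ~~ adjacent i j ->
  swap i f j = f j /\ swap i f (nx j) = f (nx j).
Proof.
rewrite adjacentE negb_or => ji /andP[inj jni].
by rewrite !swap_out // ?(inj_eq (@nx_inj _)) // eq_sym.
Qed.

(** The exchange property: the start has no descent, so a descent at the end was created by the
    path, and braid moves bring its letter to the front. The induction on length works inside the
    dihedral subgroup of [i] and [j]. *)
Lemma exchange_size n t j f : (size t <= n)%N -> no_descent f -> ascending t f ->
  walk t f j + 2 <= walk t f (nx j) ->
  exists2 s, ascending (j :: s) f & braid_eq t (j :: s).
Proof.
move=> tn fd; elim: n t j tn => [|n IHn] [|i t] j //= tn; try by have := fd j; lia.
case/andP=> tf; set g := walk t f => gi gj.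
have done s : braid_eq (i :: t) (j :: s) ->
    exists2 s, ascending (j :: s) f & braid_eq (i :: t) (j :: s).
  move=> ts; exists s => //; case/(braid_eq_act f): (ts) => <- _.
  by rewrite /= tf.
move: gi gj; have [->|ji] := eqVneq j i.
  by move=> gi gj; exists t; rewrite /= ?tf.
have [aij|naij] := boolP (adjacent i j); last first.
  have [-> ->] := swap_far g ji naij.
  move=> gi gj; have [s sf ts] := IHn _ _ tn tf gj.
  by apply: (done (i :: s)); apply: (braid_eq_trans (braid_eq_cons i ts));
    apply: braid_eq_comm.
rewrite eq_sym in ji; case: (adjacentP ji aij) => [] [k1 E]; subst; rewrite /ascent.
(* For k = 1 there is no braid relation, but after the ascent [i] the other letter ascends too, so
   it cannot be a descent. *)
- by rewrite nx2K // swap_l swap_r; lia.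
(* The descent at [nx i] was there before the step [i], so induction puts [nx i] at the head of [t],
   then [i] at the head of the rest, and a braid move finishes. *)
- rewrite swap_r // swap_nx2 // => gi gj.
  have [|s sf ts] := IHn t (nx i) tn tf; first by rewrite -/g; lia.
  have gs : swap (nx i) g = walk s f.
    by have [_ e] := braid_eq_act f ts; rewrite /g e /= swapK.
  have [_ _ sz _] := ts; move: sf => /= /andP[sf _].
  have [||r _ sr] := IHn s i _ sf; [by move: sz tn => /=; lia| |].
    by rewrite -gs swap_prev // swap_l -/g; lia.
  apply: (done (i :: nx i :: r)).
  apply: (braid_eq_trans (braid_eq_cons i ts));
    apply: (braid_eq_trans _ (braid_eq_braid _ r k1)).
  exact/braid_eq_cons/braid_eq_cons.
- rewrite swap_prev // swap_l => gi gj.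
  have [|s sf ts] := IHn t j tn tf; first by rewrite -/g; lia.
  have gs : swap (j) g = walk s f.
    by have [_ e] := braid_eq_act f ts; rewrite /g e /= swapK.
  have [_ _ sz _] := ts; move: sf => /= /andP[sf _].
  have [||r _ sr] := IHn s (nx j) _ sf; [by move: sz tn => /=; lia| |].
    by rewrite -gs swap_r // swap_nx2 // -/g; lia.
  apply: (done (nx j :: j :: r)).
  apply: (braid_eq_trans (braid_eq_cons _ ts));
    apply: (braid_eq_trans _ (braid_eq_sym (braid_eq_braid _ r k1))).
  exact/braid_eq_cons/braid_eq_cons.
Qed.

Lemma exchange t j f : no_descent f -> ascending t f ->
  walk t f j + 2 <= walk t f (nx j) ->
  exists2 s, ascending (j :: s) f & braid_eq t (j :: s).
Proof. exact: (@exchange_size (size t)). Qed.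

(** Conjugating [s_j] back along the path gives a simple reflection fixing the start: the case where
    left multiplication by a generator does not leave the coset. *)
Lemma fixed_letter_size n t j f : (size t <= n)%N -> no_descent f ->
  ascending t f ->
  walk t f (nx j) = walk t f j + 1 ->
  exists2 l, f (nx l) = f l + 1 & s_word (j :: t) = s_word (rcons t l).
Proof.
move=> tn fd; elim: n t j tn => [|n IHn] [|i t] j //= tn; try by exists j.
case/andP=> tf; set g := walk t f => gi gj.
move: gi gj; have [->|ji] := eqVneq j i.
  by rewrite swap_l swap_r // /ascent => gi gj; exfalso; lia.
have [aij|naij] := boolP (adjacent i j); last first.
  have [-> ->] := swap_far g ji naij.
  move=> gi gj; have [l fl tl] := IHn _ _ tn tf gj; exists l => //.
  rewrite -s_word_comm //.
  by have := s_word_ctx [:: i] [::] tl; rewrite !cats0.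
have ext i1 i2 (s1 s2 : seq I) : s_word s1 = s_word s2 ->
    s_word [:: i1, i2 & s1] = s_word [:: i1, i2 & s2].
  by move=> e; have := s_word_ctx [:: i1; i2] [::] e; rewrite !cats0.
have ext1 i1 (s1 s2 : seq I) : s_word s1 = s_word s2 ->
    s_word (i1 :: s1) = s_word (i1 :: s2).
  by move=> e; have := s_word_ctx [:: i1] [::] e; rewrite !cats0.
have extr l (s1 s2 : seq I) : s_word s1 = s_word s2 ->
    s_word (rcons s1 l) = s_word (rcons s2 l).
  by move=> e; have := s_word_ctx [::] [:: l] e; rewrite /= !cats1.
rewrite eq_sym in ji; case: (adjacentP ji aij) => [] [k1 E]; subst; rewrite /ascent.
- by rewrite nx2K // swap_l swap_r // => gi gj; exfalso; lia.
- rewrite swap_r // swap_nx2 // => gi gj.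
  have [|s sf ts] := @exchange t (nx i) f fd tf; first by rewrite -/g; lia.
  have gs : swap (nx i) g = walk s f.
    by have [_ e] := braid_eq_act f ts; rewrite /g e /= swapK.
  have [_ ets sz _] := ts; move: sf => /= /andP[sf _].
  have [||l fl sl] := IHn s i _ sf; [by move: sz tn => /=; lia| |].
    by rewrite -gs swap_prev // swap_l -/g; lia.
  exists l => //; rewrite (ext _ _ _ _ ets) -s_word_braid // (ext _ _ _ _ sl).
  exact/ext1/esym/(extr l t (nx i :: s)).
- rewrite swap_prev // swap_l => gi gj.
  have [|s sf ts] := @exchange t j f fd tf; first by rewrite -/g; lia.
  have gs : swap (j) g = walk s f.
    by have [_ e] := braid_eq_act f ts; rewrite /g e /= swapK.
  have [_ ets sz _] := ts; move: sf => /= /andP[sf _].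
  have [||l fl sl] := IHn s (nx j) _ sf; [by move: sz tn => /=; lia| |].
    by rewrite -gs swap_r // swap_nx2 // -/g; lia.
  exists l => //; rewrite (ext _ _ _ _ ets) s_word_braid // (ext _ _ _ _ sl).
  exact/ext1/esym/(extr l t (j :: s)).
Qed.

Lemma fixed_letter t j f : no_descent f -> ascending t f ->
  walk t f (nx j) = walk t f j + 1 ->
  exists2 l, f (nx l) = f l + 1 & s_word (j :: t) = s_word (rcons t l).
Proof. exact: (@fixed_letter_size (size t)). Qed.

Lemma ascent_desc i f : ascent i f -> swap i f i + 2 <= swap i f (nx i).
Proof. by rewrite /ascent swap_l swap_r //; lia. Qed.

Lemma ascent_words_braid_eq s t f : no_descent f -> ascending s f ->
  ascending t f -> walk s f = walk t f ->
  braid_eq s t.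
Proof.
move=> fd; elim: s t => [|i s IHs] t /=.
  case: t => [//|j t] _ /= /andP[_ /ascent_desc tj] e.
  by move: (fd j) tj; rewrite -e; lia.
case/andP=> sf si tf e.
have [|r rf tr] := exchange (j := i) fd tf; first by rewrite -e; apply: ascent_desc.
have [_ er] := braid_eq_act f tr.
apply: braid_eq_trans (braid_eq_sym tr); apply/braid_eq_cons/IHs => //.
  by case/andP: rf.
by apply: (can_inj (swapK hk i)); rewrite e.
Qed.

Definition fixes f i := f (nx i) == f i + 1.

Lemma walk_fixes t f : all (fixes f) t -> walk t f = f.
Proof. by elim: t => [|i t IHt] //= /andP[/eqP fi /IHt ->]; apply: swap_fix. Qed.

(** Factors a word into a minimal coset representative and an element of the stabilizer, one letter
    at a time: an ascent extends [s], a fixed letter passes through [s] into [r], a descent cancels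
    the head of [s]. The final alternative detects reduced words. *)
Lemma ascending_word t f : no_descent f ->
  exists s r, [/\ ascending s f, all (fixes f) r, s_word t = s_word (s ++ r),
    (size s <= size t)%N & ascending t f \/ (size s < size t)%N].
Proof.
move=> fd; elim: t => [|i t [s [r [sf rf tsr st IHd]]]].
  by exists [::], [::]; split=> //; left.
have tf : walk t f = walk s f.
  by rewrite (walk_s_word hk f tsr) walk_cat (walk_fixes rf).
have tsr' : s_word (i :: t) = s_word (i :: s ++ r).
  by have := s_word_ctx [:: i] [::] tsr; rewrite !cats0.
have [gi|] := boolP (ascent i (walk s f)).
  exists (i :: s), r; split=> //=; rewrite ?sf //.
  by case: IHd => [->|]; [left; rewrite tf|right].
rewrite /ascent -ltNge => gi.
have [e|ne] := eqVneq (walk s f (nx i)) (walk s f i + 1).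
  have [l fl sl] := fixed_letter fd sf e.
  exists s, (l :: r); split=> //=; rewrite ?rf ?andbT; first exact/eqP.
  - rewrite tsr' -cat_cons s_word_cat sl -s_word_cat -cats1 -catA //.
  - exact: leqW.
  - by right.
have [|s' sf' ss'] := exchange (j := i) fd sf; first by lia.
have [_ e s's _] := ss'.
exists s', r; split=> //=.
- by case/andP: sf'.
- rewrite tsr' -cat_cons s_word_cat.
  have -> : s_word (i :: s) = s_word s'.
    rewrite -(s_word_sq i s').
    by have := s_word_ctx [:: i] [::] e; rewrite !cats0.
  by rewrite -s_word_cat.
- by move: s's st => /=; lia.
- by right; move: s's st => /=; lia.
Qed.

End Words.

(** * The two base states *)

Section Bases.
Variables (K : comNzRingType) (k : nat).
Hypothesis hk : (0 < k)%N.
Local Notation I := 'I_k.+1.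
Implicit Types (i j l : I) (s t : seq I) (f g : state k) (w : affS k).

Lemma val_nx i : nx i = (if i == k :> nat then 0 else i.+1)%N :> nat.
Proof.
rewrite /= modnDmr addn1; case: eqP => [->|ik]; first by rewrite modnn.
by rewrite modn_small // ltnS ltn_neqAle -ltnS ltn_ord andbT; apply/eqP.
Qed.

Definition zero_state : state k := [ffun=> 0].
(** The beads of the empty partition are the integers z <= 0, so the first gap is i for residues i
    from 1 to k, and k + 1 for residue 0. *)
Definition grass0 : state k :=
  [ffun i : I => if i == 0 then k.+1%:Z else (i : nat)%:Z].

Lemma no_descent_zero_state : no_descent zero_state.
Proof. by move=> i; rewrite !ffunE. Qed.

Lemma fixes_zero_state i : fixes zero_state i = false.
Proof. by rewrite /fixes !ffunE. Qed.

Lemma grassE i : grass0 i = if (i == 0 :> nat)%N then k.+1%:Z else (i : nat)%:Z.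
Proof. by rewrite ffunE -val_eqE. Qed.

Lemma no_descent_grass0 : no_descent grass0.
Proof.
move=> i; rewrite !grassE val_nx.
by have := ltn_ord i; case: (i == k :> nat) / eqP; case: (i == 0 :> nat)%N / eqP;
  rewrite /=; lia.
Qed.

Lemma fixes_grass0 i : fixes grass0 i = (i != 0).
Proof.
rewrite /fixes !grassE val_nx -val_eqE /=.
by have := ltn_ord i; case: (i == k :> nat) / eqP; case: (i == 0 :> nat)%N / eqP;
  rewrite /=; lia.
Qed.

Lemma all_fixes_zero_state t : all (fixes zero_state) t -> t = [::].
Proof. by case: t => //= i t; rewrite fixes_zero_state. Qed.

Lemma ascending_zero_state_reduced t : ascending t zero_state <-> reduced t.
Proof.
split=> [tr t' e|rt].
  have [s [r [sr /all_fixes_zero_state ->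
    {r} t's st' _]]] := ascending_word K hk t' no_descent_zero_state.
  rewrite cats0 in t's; suff [_ _ -> _]: braid_eq K t s by [].
  apply: ascent_words_braid_eq no_descent_zero_state tr sr _ => //.
  by apply: walk_s_word; rewrite // -e.
have [s [r [sr /all_fixes_zero_state ->
  {r} ts st [//|]]]] := ascending_word K hk t no_descent_zero_state.
by rewrite cats0 in ts; rewrite ltnNge rt.
Qed.

Lemma ascending_grass0_reduced t : ascending t grass0 -> reduced t.
Proof.
move=> tg t' e.
have [s [r [sg rf t's st' _]]] := ascending_word K hk t' no_descent_grass0.
suff [_ _ -> _]: braid_eq K t s by [].
apply: ascent_words_braid_eq no_descent_grass0 tg sg _ => //.
by rewrite -(walk_s_word hk _ e) (walk_s_word hk _ t's) walk_cat (walk_fixes rf).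
Qed.

Lemma reduced_word_s_word t : reduced t -> size (reduced_word (s_word t)) = size t.
Proof.
move=> rt; have [e rr] := reduced_wordP (s_word t).
by apply/eqP; rewrite eqn_leq rr ?rt.
Qed.

Lemma in_W0_fixes r : all (fixes grass0) r <-> ord0 \notin r.
Proof.
split=> [/allP rg|r0]; first by apply/negP => /rg; rewrite fixes_grass0 eqxx.
apply/allP => i ir; rewrite fixes_grass0; apply: contraNneq r0 => i0.
have e : i = ord0 by apply: val_inj; rewrite i0.
by rewrite -e.
Qed.

Lemma ascending_grass0_minW0 t : ascending t grass0 -> in_minW0 (s_word t).
Proof.
move=> tg v [r /in_W0_fixes rf ->].
rewrite /lengthS reduced_word_s_word; last exact: ascending_grass0_reduced.
rewrite -s_word_cat; have [e _] := reduced_wordP (s_word (t ++ r)).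
set t' := reduced_word _ in e *.
have [s [r' [sg rf' t's st' _]]] := ascending_word K hk t' no_descent_grass0.
suff [_ _ -> _]: braid_eq K t s by [].
apply: ascent_words_braid_eq no_descent_grass0 tg sg _ => //.
have := walk_s_word hk grass0 t's; rewrite walk_cat (walk_fixes rf') => <-.
by rewrite (walk_s_word hk grass0 e) walk_cat (walk_fixes rf).
Qed.

Lemma minW0_ascending_grass0 w : in_minW0 w -> ascending (reduced_word w) grass0.
Proof.
move=> wmin; have [e _] := reduced_wordP w; set t := reduced_word w in e *.
have [s [r [sg rf ts st [//|]]]] := ascending_word K hk t no_descent_grass0.
rewrite ltnNge => /negP[].
have rr : s_word (rev r) = (s_word r)^-1%g by apply: s_word_rev.
have /wmin : in_W0 (s_word (rev r)).
  by exists (rev r); rewrite // mem_rev; apply/in_W0_fixes.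
move/leq_trans; apply; rewrite /lengthS.
have -> : (w * s_word (rev r))%g = s_word s by rewrite -e ts s_word_cat rr mulgK.
by rewrite reduced_word_s_word //; apply: ascending_grass0_reduced.
Qed.

Lemma reduced_catl s t : reduced (s ++ t) -> reduced s.
Proof.
move=> r s' e; have := r (s' ++ t); rewrite !s_word_cat e => /(_ erefl).
by rewrite !size_cat leq_add2r.
Qed.

(** The common part [x] can be cancelled in the group only, so the comparison moves to [zero_state],
    where ascending means reduced. *)
Lemma braid_eq_cancel s t x : ascending (s ++ x) grass0 ->
  ascending (t ++ x) grass0 ->
  walk (s ++ x) grass0 = walk (t ++ x) grass0 -> braid_eq K s t.
Proof.
move=> sx tx e.
have [_ ew _ _] := ascent_words_braid_eq K hk no_descent_grass0 sx tx e.
have {}ew : s_word s = s_word t.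
  by apply: (mulIg (s_word x)); rewrite -!s_word_cat.
have red y z : ascending (y ++ z) grass0 -> ascending y zero_state.
  by move/ascending_grass0_reduced/reduced_catl/ascending_zero_state_reduced.
apply: ascent_words_braid_eq no_descent_zero_state (red _ _ sx) (red _ _ tx) _ =>
  //.
exact: walk_s_word.
Qed.

(** At the first step that fails to ascend, exchange brings the same letter to the front of the
    earlier path, and u_i u_i = 0. *)
Lemma u_word_nonreduced t : ~~ ascending t zero_state -> u_word K t = 0.
Proof.
elim: t => //= i t IHt; have [tr /= gi|/IHt tz _] :=
  boolP (ascending t zero_state); last first.
  by rewrite u_word_cons tz mulr0.
have [e|ne] := eqVneq (walk t zero_state (nx i)) (walk t zero_state i + 1).
  have [l fl _] := fixed_letter K hk no_descent_zero_state tr e.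
  by have := fixes_zero_state l; rewrite /fixes fl eqxx.
have [|s _ [ts _ _ _]] := exchange K (j := i) hk no_descent_zero_state tr.
  by move: gi ne; rewrite /ascent; lia.
by rewrite !u_word_cons ts u_word_cons mulrA u_sq mul0r.
Qed.

Definition cong f := forall i, exists m : int, f i = (i : nat)%:Z + k.+1%:Z * m.

(* These are exactly the states reached from [grass0], see [normal_reachable]. *)
Definition normal f := cong f /\ \sum_(i < k.+1) f i = \sum_(i < k.+1) grass0 i.

Lemma swap_sum i f : \sum_(j < k.+1) swap i f j = \sum_(j < k.+1) f j.
Proof.
rewrite (bigD1 i) //= (bigD1 (nx i)) ?nx_neq //= [RHS](bigD1 i) //=.
rewrite [X in _ = _ + X](bigD1 (nx i)) ?nx_neq //= swap_l swap_r //.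
set S := (X in _ = _ + (_ + X)); rewrite (_ : \sum_(j | _) _ = S); first by lia.
by apply: eq_bigr => j /andP[ji jn]; rewrite swap_out.
Qed.

Lemma nx_mod i : exists m : int, (nx i : nat)%:Z = (i : nat)%:Z + 1 + k.+1%:Z * m.
Proof.
rewrite val_nx; case: eqP => [->|_]; [exists (-1)|exists 0]; lia.
Qed.

Lemma cong_swap i f : cong f -> cong (swap i f).
Proof.
move=> fc j; have [m1 e1] := nx_mod i.
case: (eqVneq j i) => [->|ji].
  by rewrite swap_l; have [m ->] := fc (nx i); exists (m1 + m); rewrite e1; lia.
case: (eqVneq j (nx i)) => [->|jn]; last by rewrite swap_out.
by rewrite swap_r // e1; have [m ->] := fc i; exists (m - m1); lia.
Qed.

Lemma normal_walk t f : normal f -> normal (walk t f).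
Proof.
move=> fn; elim: t => [|i t [c e]] //=.
by split; [apply: cong_swap|rewrite swap_sum].
Qed.

Lemma normal_grass0 : normal grass0.
Proof.
split=> // i; rewrite ffunE; case: eqP => [->|_]; [exists 1|exists 0] => /=; lia.
Qed.

Lemma size_bound t f i j (b : int) : (forall i j, f i - f j <= b) ->
  walk t f i - walk t f j <= b + 2 * (size t)%:Z.
Proof.
move=> fb; elim: t i j => [|l t IHt] i j /=; first by have := fb i j; lia.
have H a c : walk t f a - walk t f c <= b + 2 * (size t)%:Z by apply: IHt.
have E a : exists e c, swap l (walk t f) a = walk t f c + e /\ -1 <= e <= 1.
  rewrite ffunE; case: eqVneq => _; first by exists (-1), (nx l); split; lia.
  case: eqVneq => _; [exists 1, l|exists 0, a]; split; lia.
have [e1 [c1 [-> h1]]] := E i; have [e2 [c2 [-> h2]]] := E j.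
by have := H c1 c2; lia.
Qed.

Lemma grass0_bound i j : grass0 i - grass0 j <= k.+1%:Z.
Proof. by rewrite !ffunE; have := ltn_ord i; have := ltn_ord j; do 2!case: ifP;
  lia. Qed.

(* The path [t], the first part of a reduced path [s ++ t], leads from the state
   [deep N (s ++ t) [::]] to this one; for large [N] its steps ascend because
   they do when the path starts at 0. *)
Definition deep (N : nat) s t : state k :=
  [ffun i => walk t grass0 i + N%:Z * (walk t zero_state i - walk (rev s)
    zero_state i)].

Lemma swap_deep N i s t : deep N s (i :: t) = swap i (deep N (rcons s i) t).
Proof.
have E : walk (rev (rcons s i)) zero_state = swap i (walk (rev s) zero_state) by
  rewrite rev_rcons.
have D j : deep N (rcons s i) t j =
    walk t grass0 j + N%:Z * (walk t zero_state j - swap i (walk (rev s)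
      zero_state) j).
  by rewrite ffunE E.
apply/ffunP => j; rewrite [LHS]ffunE /=.
have [->|ji] := eqVneq j i; first by rewrite !swap_l D swap_r //; lia.
have [->|jn] := eqVneq j (nx i); first by rewrite !swap_r // D swap_l; lia.
by rewrite !swap_out // D swap_out.
Qed.

Lemma reduced_rev t : reduced t -> reduced (rev t).
Proof.
move=> rt t' e; rewrite size_rev -(size_rev t'); apply: rt.
have rr x : s_word (rev x) = (s_word x)^-1%g by apply: s_word_rev.
by rewrite rr e rr invgK.
Qed.

(** In the difference tested, [N] has coefficient at most -2: the walk [t] ascends at [i], and
    [i :: rev s], part of a reversed reduced word, is reduced, so its endpoint descends at [i]. This
    outweighs the spread of [walk t grass0], whence the bound on [N]. *)
Lemma deep_step N i s t : ascending (rcons s i ++ t) zero_state ->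
  (k.+1 + 2 * size t <= N)%N -> ascent i (deep N (rcons s i) t).
Proof.
move=> st tN; have ti : ascending (i :: t) zero_state.
  by move: st; rewrite cat_rcons ascending_cat => /andP[].
have /=/andP[_ si] : ascending (i :: rev s) zero_state.
  rewrite -rev_rcons; apply/ascending_zero_state_reduced/reduced_rev.
  by apply: (@reduced_catl _ t); apply/ascending_zero_state_reduced.
have {si} := ascent_desc hk si; move: ti => /= /andP[_].
have E : walk (rev (rcons s i)) zero_state = swap i (walk (rev s) zero_state) by
  rewrite rev_rcons.
have D j : deep N (rcons s i) t j =
    walk t grass0 j + N%:Z * (walk t zero_state j - swap i (walk (rev s)
      zero_state) j).
  by rewrite ffunE E.
rewrite /ascent !D.
have := size_bound t (nx i) i grass0_bound.
nia.
Qed.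

Lemma ascending_deep N s t : ascending (s ++ t) zero_state ->
  (k.+1 + 2 * size (s ++ t) <= N)%N -> ascending t (deep N (s ++ t) [::]) /\
  walk t (deep N (s ++ t) [::]) = deep N s t.
Proof.
elim: t s => [|i t IHt] s; first by rewrite cats0.
rewrite -cat_rcons => st stN; have [ut at_] := IHt _ st stN.
rewrite /= ut at_ deep_step -?swap_deep //.
by apply: leq_trans stN; rewrite size_cat; lia.
Qed.

(** A multiple of k + 1 keeps the residues, and the sum is unchanged because swaps preserve sums. *)
Lemma deep_normal n s : normal (deep (k.+1 * n) s [::]).
Proof.
have [gc _] := normal_grass0; split=> [i|].
  have [m e] := gc i; rewrite ffunE /= e.
  by exists (m + n%:Z * (zero_state i - walk (rev s) zero_state i));
    rewrite PoszM; lia.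
under eq_bigr do rewrite ffunE /=.
rewrite big_split /= -mulr_sumr sumrB.
have -> : \sum_(i < k.+1) walk (rev s) zero_state i = \sum_(i < k.+1) zero_state i.
  by elim: (rev s) => //= i r IHr; rewrite swap_sum.
by rewrite subrr mulr0 addr0.
Qed.

Lemma grass0_ascending_exists (t : seq I) : ascending t zero_state ->
  exists2 f, normal f & ascending t f.
Proof.
move=> tr; pose N := (k.+1 * (k.+1 + 2 * size t))%N.
exists (deep N t [::]); first exact: deep_normal.
by have [|//] := @ascending_deep N [::] t tr; rewrite leq_pmull.
Qed.

End Bases.

(** * Cyclically decreasing words *)

Section Decreasing.
Variable k : nat.
Hypothesis hk : (0 < k)%N.
Local Notation I := 'I_k.+1.
Implicit Types (i j l a x y : I) (s t : seq I) (f g : state k) (z : int).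

Definition residue z : I := inZp `|(z %% k.+1%:Z)%Z|.

Lemma val_residue z : (residue z : nat)%:Z = (z %% k.+1%:Z)%Z.
Proof.
have z0 : (0 <= z %% k.+1%:Z)%Z by apply: modz_ge0.
have zk : ((z %% k.+1%:Z)%Z < k.+1%:Z) by apply: ltz_pmod.
by rewrite /= modn_small; lia.
Qed.

Lemma residueE z : exists m : int, z = (residue z : nat)%:Z + k.+1%:Z * m.
Proof. by exists (z %/ k.+1%:Z)%Z; rewrite val_residue {1}(divz_eq z k.+1);
  lia. Qed.

Lemma residue_uniq z i (m : int) : z = (i : nat)%:Z + k.+1%:Z * m -> residue z = i.
Proof.
move=> e; apply/val_inj/eqP; rewrite -eqz_nat val_residue e addrC mulrC modzMDl.
by rewrite modz_small //; have := ltn_ord i; lia.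
Qed.

Lemma residueDn z (m : int) : residue (z + k.+1%:Z * m) = residue z.
Proof. by have [m1 e] := residueE z; apply: (@residue_uniq _ _ (m1 + m)); lia. Qed.

Lemma residueS z : residue (z + 1) = nx (residue z).
Proof.
have [m e] := residueE z; have [m1 e1] := nx_mod hk (residue z).
by apply: (@residue_uniq _ _ (m - m1)); lia.
Qed.

Lemma residue_eq z z' : residue z = residue z' ->
  exists m : int, z = z' + k.+1%:Z * m.
Proof.
move=> e; have [m ez] := residueE z; have [m' ez'] := residueE z'.
by exists (m - m'); move: ez ez'; rewrite e; lia.
Qed.

Lemma cong_residue f : cong f <-> forall i, residue (f i) = i.
Proof.
split=> fc i; first by have [m] := fc i; apply: residue_uniq.
by have [m] := residueE (f i); rewrite fc; exists m.
Qed.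

Lemma residue_iter z n : residue (z + n%:Z) = iter n (@nx k) (residue z).
Proof. by elim: n => [|n IHn]; rewrite ?addr0 //= -IHn -residueS; congr residue;
  lia. Qed.

Lemma iter_nx_inj a m n : (m <= k)%N -> (n <= k)%N ->
  iter m (@nx k) a = iter n (@nx k) a -> m = n.
Proof.
move=> mk nk; have -> : a = residue (a : nat)%:Z.
  by apply/esym/(@residue_uniq _ _ 0); lia.
rewrite -!residue_iter => /residue_eq[q e]; case: (ltgtP q 0) => [q0|q0|q0];
  [nia|nia|].
by rewrite q0 in e; lia.
Qed.

(** Cyclic decrease as a local condition, independent of the missing residue that [decreasing_word]
    picks. *)
Fixpoint dec t := if t is i :: t1 then [&& i \notin t1, nx i \notin t1 & dec t1]
  else true.

Lemma dec_word (D : {set I}) : D \proper [set: I] -> dec (decreasing_word D).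
Proof.
move=> /decreasing_wordP[uD mD oD].
have {}oD j : j \in decreasing_word D -> nx j \in decreasing_word D ->
    (index (nx j) (decreasing_word D) < index j (decreasing_word D))%N.
  by rewrite !mD; apply: oD.
elim: (decreasing_word D) uD oD => //= i t IHt /andP[it ut] idx.
rewrite it IHt // => [|j jt njt].
  rewrite andbT; apply/negP => nit.
  by have := idx i; rewrite !inE eqxx nit orbT => /(_ isT isT).
have := idx j; rewrite !inE jt njt !orbT => /(_ isT isT).
have /negbTE -> : i != j by apply: contraNneq it => ->.
by have /negbTE -> : i != nx j by apply: contraNneq it => ->.
Qed.


(** In a run of letters the lowest acts first: each letter x inherits the value at [nx x], and the
    value at the bottom of the run is carried past its top, where a lower bound is enough here. *)
Lemma dec_effect t f : dec t -> ascending t f -> forall x,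
  if x \in t then walk t f x = f (nx x) - 1 else
  [/\ f x <= walk t f x, forall y, y \in t -> x = nx y -> f x + 1 <= walk t f x
    & (forall y, x = nx y -> y \notin t) -> walk t f x = f x].
Proof.
elim: t => [|i t IHt] /= dt tf x; first by split.
case/and3P: dt => it nit dt; case/andP: tf => tf fi.
have {IHt} IH := IHt dt tf; rewrite inE.
have [->|xi] /= := eqVneq x i.
  rewrite swap_l; congr (_ - 1); have := IH (nx i); rewrite (negbTE nit).
  by case=> _ _; apply=> y /(@nx_inj _) <-.
have [->|xn] := eqVneq x (nx i).
  rewrite (negbTE nit) swap_r //; have := IH (nx i);
    rewrite (negbTE nit) => -[h _ _].
  move: fi; rewrite /ascent => fi; split=> [|y _ _|H]; [lia|lia|].
  by have := H i erefl; rewrite !inE eqxx.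
rewrite swap_out //; have := IH x; case: ifP => // xt [h1 h2 h3]; split=> //.
  move=> y; rewrite inE => /orP[/eqP ->|]; last exact: h2.
  by move=> e; rewrite e eqxx in xn.
by move=> H; apply: h3 => y /H; rewrite inE negb_or => /andP[].
Qed.

(** Undoing the run brings the value just beyond it back to [a] and moves the consecutive values up
    by one place; the strict jump beyond the run makes every undone step an ascent. *)
Lemma block_step n t a f : (n <= k)%N -> dec t -> t =i traject (@nx k) a n ->
  (forall m, (m < n)%N -> f (iter m (@nx k) a) = f a + m%:Z) ->
  ((0 < n)%N -> f a + n%:Z + 1 <= f (iter n (@nx k) a)) ->
  exists g, [/\ ascending t g, walk t g = f & g a = f (iter n (@nx k) a) - n%:Z].
Proof.
elim: n t f => [|n IHn] t f nk dt ta fa fn.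
  exists f; case: t dt ta => [_ _|i t _ /(_ i)]; last by rewrite inE eqxx.
  by split=> //=; rewrite subr0.
case: t dt ta => [|i t]; first by move=> _ /(_ a); rewrite /= !inE eqxx.
move=> dt0 ta; have /= /and3P[it nit dt] := dt0.
have ei : i = iter n (@nx k) a.
  have : i \in traject (@nx k) a n.+1 by rewrite -ta inE eqxx.
  case/trajectP => m mn e; have [<-//|m_n] := eqVneq m n.
  have : nx i \in i :: t.
    rewrite ta; apply/trajectP; exists m.+1; last by rewrite e.
    by rewrite ltn_neqAle eqSS m_n.
  by rewrite inE nx_neq // (negbTE nit).
have ta' : t =i traject (@nx k) a n.
  move=> y; have := ta y; rewrite trajectSr mem_rcons !inE -ei.
  have [->|//] := eqVneq y i; rewrite (negbTE it) => _.
  apply/esym/negP => /trajectP[m mn]; rewrite ei => /iter_nx_inj e.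
  by have nm : n = m by [apply: e; lia]; rewrite nm ltnn in mn.
have far m : (m < n)%N -> swap i f (iter m (@nx k) a) = f (iter m (@nx k) a).
  move=> mn; have ne p : (m < p <= k)%N -> iter m (@nx k) a != iter p (@nx k) a.
    by move=> mp; apply/eqP => /iter_nx_inj e; have mp' : m = p by [apply: e;
      lia]; lia.
  by rewrite swap_out // ei -?iterS ne //; lia.
have fi : f i = f a + n%:Z by rewrite ei fa.
have fni : f a + n%:Z + 2 <= f (nx i) by rewrite ei -iterS; have := fn isT; lia.
have si : swap i f (iter n (@nx k) a) = f (nx i) - 1 by rewrite -ei swap_l.
have [|||g [tg eg ga]] := IHn t (swap i f) _ dt ta'; first exact: ltnW.
- move=> m mn; rewrite far // fa ?ltnS 1?ltnW //.
  by have := far 0 (leq_ltn_trans (leq0n m) mn); rewrite /= => ->.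
- by move=> n0; rewrite si; have := far 0 n0; rewrite /= => ->; lia.
exists g; rewrite /= tg eg swapK // ga si; split=> //; last by rewrite ei; lia.
by rewrite /ascent swap_l swap_r //; lia.
Qed.

End Decreasing.

(** * Reaching the states of the orbit *)

Section NormalInduction.
Variable k : nat.
Hypothesis hk : (0 < k)%N.
Local Notation I := 'I_k.+1.
Implicit Types (i j l a x y : I) (s t : seq I) (f g : state k) (z : int).
Implicit Types D : {set I}.

Lemma grass0_le f i : cong f -> 1 <= f i -> grass0 k i <= f i.
Proof.
move=> fc f1; rewrite grassE; have [m e] := fc i; have := ltn_ord i;
  rewrite e in f1 *.
case: eqP => i0 ik.
  by have [m0|m0] : m <= 0 \/ 1 <= m by [lia]; nia.
by have [m0|m0] : m <= -1 \/ 0 <= m by [lia]; nia.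
Qed.

Lemma grass0_ge f i : cong f -> f i <= k.+1%:Z -> f i <= grass0 k i.
Proof.
move=> fc f1; rewrite grassE; have [m e] := fc i; have := ltn_ord i;
  rewrite e in f1 *.
case: eqP => i0 ik.
  by have [m0|m0] : m <= 1 \/ 2 <= m by [lia]; nia.
by have [m0|m0] : m <= 0 \/ 1 <= m by [lia]; nia.
Qed.

Lemma normal_le f : normal f -> (forall i, grass0 k i <= f i) -> f = grass0 k.
Proof.
case=> _ e h; apply/ffunP => i; apply/eqP; rewrite eq_sym.
have /eqP : \sum_(i < k.+1) (f i - grass0 k i) = 0 by rewrite sumrB e subrr.
rewrite psumr_eq0 => [/allP/(_ i)|j _]; last by rewrite subr_ge0.
by rewrite mem_index_enum subr_eq0 eq_sym /=; apply.
Qed.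

Lemma normal_ge f : normal f -> (forall i, f i <= grass0 k i) -> f = grass0 k.
Proof.
case=> _ e h; apply/ffunP => i; apply/eqP.
have /eqP : \sum_(i < k.+1) (grass0 k i - f i) = 0 by rewrite sumrB e subrr.
rewrite psumr_eq0 => [/allP/(_ i)|j _]; last by rewrite subr_ge0.
by rewrite mem_index_enum subr_eq0 eq_sym /=; apply.
Qed.

Lemma residue_small (m : nat) : (m <= k)%N -> (residue k m%:Z : nat) = m.
Proof. by move=> mk; have := val_residue hk m%:Z; rewrite modz_small; lia. Qed.

Lemma grass1 : grass0 k (residue k 1) = 1.
Proof. by rewrite grassE (@residue_small 1). Qed.

(* Every state of the orbit other than [grass0] arises, along some u_D, from a
   state with larger minimum; the other u_D' with |D'| = |D| lead from that
   state to states with larger minimum or with the same minimum but a shorter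
   run of consecutive values starting at the minimum. *)
Lemma normal_ind (P : state k -> Prop) :
  P (grass0 k) ->
  (forall f g D, normal g -> (1 <= #|D| <= k)%N -> D \proper [set: I] ->
     ascending (decreasing_word D) g -> walk (decreasing_word D) g = f -> P g ->
     (forall D', D' \proper [set: I] -> #|D'| = #|D| ->
        ascending (decreasing_word D') g -> D' != D ->
          P (walk (decreasing_word D') g)) ->
     P f) ->
  forall f, normal f -> P f.
Proof.
move=> P0 PS.
(* The constant 2 makes the case m = 0 vacuous: a normal state with all values at least 2 dominates
   [grass0], hence equals it, but [grass0] takes the value 1. *)
suff main m f : normal f -> (forall i, 2 - m%:Z <= f i) -> P f.
  move=> f fn; apply: (main (2 + \sum_(i < k.+1) `|f i|)%N) => // i.
  have : (`|f i| <= \sum_(i < k.+1) `|f i|)%N by rewrite (bigD1 i) //= leq_addr.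
  by lia.
elim: m f => [|m IHm] f fn fm.
  have e : f = grass0 k.
    apply: normal_le => // i; apply: grass0_le; first by case: fn.
    by have := fm i; lia.
  by have := fm (residue k 1); rewrite e grass1.
set b := 2 - m.+1%:Z in fm; set a := residue k b.
have out g : normal g -> (forall i, b <= g i) -> g a != b -> P g.
  move=> gn gb ga; apply: IHm => // i.
  have : g i != b.
    apply: contraNneq ga => e; have /(cong_residue hk)/(_ i) : cong g by case: gn.
    by rewrite e -/a => ->; apply/eqP.
  by have := gb i; rewrite /b; lia.
(* The hypothesis says that the values along [a, nx a, ...] cease to be b, b + 1, ... before place
   j. A break at the last allowed place, unless this is place 0, is where the hypothesis on [P] is
   used. *)
have inner (j : nat) g : (j <= k.+1)%N -> normal g -> (forall i, b <= g i) ->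
    (exists2 l : nat, (l < j)%N & g (iter l (@nx k) a) != b + l%:Z) -> P g.
  elim: j g => [|j IHj] g jk gn gb; first by case.
  case=> l lj gl.
  have [[l' l'j gl']|nex] :=
      pselect (exists2 l : nat, (l < j)%N & g (iter l (@nx k) a) != b + l%:Z).
    by apply: IHj => //; [apply: ltnW|exists l'].
  have run (l' : nat) : (l' < j)%N -> g (iter l' (@nx k) a) = b + l'%:Z.
    by move=> l'j; apply/eqP/negPn/negP => gl'; apply: nex; exists l'.
  have {l lj}gl : g (iter j (@nx k) a) != b + j%:Z.
    move: lj; rewrite ltnS leq_eqVlt => /orP[/eqP <- //|lj].
    by rewrite run ?eqxx in gl.
  have [j0|j0] := posnP j.
    by apply: out => //; move: gl; rewrite j0 addr0.
  have gc : forall i, residue k (g i) = i by apply/(cong_residue hk); case: gn.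
  have ga : g a = b by have := run 0%N j0; rewrite /= addr0.
  have glb : b + j%:Z + 1 <= g (iter j (@nx k) a).
    have : residue k (g (iter j (@nx k) a)) = residue k (b + j%:Z) by rewrite gc
      (residue_iter hk).
    move=> /(residue_eq hk)[q eq]; have := gb (iter j (@nx k) a);
      rewrite eq in gl *.
    have [q0|q0] : q <= -1 \/ 0 <= q by lia.
      by nia.
    have [q1|q1] : q = 0 \/ 1 <= q by lia.
      by rewrite q1 mulr0 addr0 eqxx in gl.
    by nia.
  (* The letters of the run: undoing them gives a predecessor [f'] in which the minimal value b has
     disappeared. *)
  pose D := [set i in traject (@nx k) a j].
  have cD : #|D| = j.
    rewrite cardsE (card_uniqP _) ?size_traject //.
    apply/(uniqP a) => x y; rewrite !inE size_traject => xj yj.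
    by rewrite !nth_traject //; apply: iter_nx_inj; lia.
  have Dp : D \proper [set: I].
    rewrite properE subsetT /=; apply/negP => /subset_leq_card.
    by rewrite cD cardsT card_ord leqNgt jk.
  have [_ memD _] := decreasing_wordP Dp; set t := decreasing_word D in memD.
  have tD : t =i traject (@nx k) a j by move=> x; rewrite memD inE.
  have dt : dec t by apply: dec_word.
  have [||f' [tf' ef' fa']] := block_step hk (f := g) jk dt tD.
  - by move=> p pj; rewrite run // ga.
  - by rewrite ga.
  have f'n : normal f' by rewrite -(walk_revK hk t f') ef'; apply: normal_walk.
  have ineff x := dec_effect hk dt tf' x.
  have f'b i : b + 1 <= f' i.
    have [->|ia] := eqVneq i a; first by rewrite fa'; lia.
    have [/existsP[p /eqP ip]|ni] :=
      boolP [exists p : 'I_j, i == iter p.+1 (@nx k) a].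
      have := ineff (iter p (@nx k) a); rewrite ef' tD.
      have -> : iter p (@nx k) a \in traject (@nx k) a j by apply/trajectP;
        exists p.
      by rewrite run // -iterS -ip; lia.
    have it : i \notin t.
      rewrite tD; apply: contra ni => /trajectP[[|p] pj ip];
        first by rewrite ip eqxx in ia.
      by apply/existsP; exists (Ordinal (ltnW pj)); rewrite /= ip.
    have := ineff i; rewrite (negbTE it) ef' => -[_ _ h].
    have <- : g i = f' i.
      apply: h => y ey; apply: contra ni; rewrite tD => /trajectP[p pj yp].
      by apply/existsP; exists (Ordinal pj); rewrite /= ey yp.
    have : g i != b by apply: contraNneq ia => e; rewrite -(gc i) e.
    by have := gb i; lia.
  apply: (PS g f' D) => //; first by rewrite cD j0.
    by apply: IHm => // i; have := f'b i; rewrite /b; lia.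
  move=> D' D'p cD' uD' D'D.
  have [_ memD' _] := decreasing_wordP D'p.
  have eff x := dec_effect hk (dec_word D'p) uD' x.
  apply: IHj; first exact: ltnW.
  - exact: normal_walk.
  - move=> i; have := eff i; case: ifP => _; first by have := f'b (nx i); lia.
    by case=> h _ _; have := f'b i; lia.
  (* If the whole run survived, all its letters would lie in [D']: outside [D'] a value never drops,
     and just after a letter of [D'] it grows. Equal cardinality would then give [D' = D]. *)
  apply: contrapT => nex'.
  have all_run (p : nat) : (p < j)%N ->
      walk (decreasing_word D') f' (iter p (@nx k) a) = b + p%:Z.
    by move=> pj; apply/eqP/negPn/negP => h; apply: nex'; exists p.
  have inD' (p : nat) : (p < j)%N -> iter p (@nx k) a \in D'.
    elim: p => [|p IHp] pj; apply/negPn/negP; rewrite -memD' => /negbTE nin.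
      have := eff (iter 0 (@nx k) a); rewrite nin all_run //= => -[h _ _].
      by have := f'b a; lia.
    have := eff (iter p.+1 (@nx k) a); rewrite nin all_run // => -[_ h _].
    have := h (iter p (@nx k) a); rewrite memD' IHp 1?ltnW // => /(_ isT erefl).
    have := ineff (iter p (@nx k) a); rewrite ef' tD.
    have -> : iter p (@nx k) a \in traject (@nx k) a j.
      by apply/trajectP; exists p => //; apply: ltnW.
    by rewrite run 1?ltnW // -iterS; lia.
  case/negP: D'D; rewrite eq_sym eqEcard cD' leqnn andbT.
  by apply/subsetP => x; rewrite inE => /trajectP[p pj ->]; apply: inD'.
have [ex|nex] := pselect (exists2 p : nat, (p < k.+1)%N & f (iter p (@nx k) a) !=
  b + p%:Z).
  exact: inner ex.
(* A run through all residues: the values are b, ..., b + k, so [f] compares with [grass0] on one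
   side, and equal sums force equality. *)
have run (p : nat) : (p < k.+1)%N -> f (iter p (@nx k) a) = b + p%:Z.
  by move=> pk; apply/eqP/negPn/negP => h; apply: nex; exists p.
have fbk i : f i <= b + k%:Z.
  have /trajectP[p pk ->] : i \in traject (@nx k) a k.+1.
    have u : uniq (traject (@nx k) a k.+1).
      apply/(uniqP a) => x y; rewrite !inE size_traject => xj yj.
      by rewrite !nth_traject //; apply: iter_nx_inj; lia.
    have cu : #|traject (@nx k) a k.+1| = #|I|.
      by rewrite (card_uniqP u) size_traject card_ord.
    by rewrite (elimT (subset_cardP cu) (subset_predT _)).
  by rewrite run //; lia.
suff -> : f = grass0 k by [].
have [b0|b1] : b <= 0 \/ b = 1 by rewrite /b; lia.
  by apply: normal_ge => // i; apply: grass0_ge; [case: fn|have := fbk i; lia].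
by apply: normal_le => // i; apply: grass0_le; [case: fn|have := fm i; lia].
Qed.

Lemma normal_reachable f : normal f ->
  exists2 t, ascending t (grass0 k) & walk t (grass0 k) = f.
Proof.
move: f; apply: normal_ind => [|f g D _ _ _ Dg <- [t tg eg] _];
  first by exists [::].
by exists (decreasing_word D ++ t); rewrite ?ascending_cat ?walk_cat ?eg // tg.
Qed.

End NormalInduction.

(** * Faithfulness *)

Section Faithful.
Variables (K : comNzRingType) (k : nat).
Hypothesis hk : (0 < k)%N.
Local Notation I := 'I_k.+1.
Local Notation A := (nilcoxeter K k).
Implicit Types (i j l : I) (s t : seq I) (f g : state k) (v : state k -> K).

Lemma u_word_pi (m : {fmonom I}) : u_word K m = \pi_A (mkmalgU m 1).
Proof.
case: m => t /=; elim: t => [|i t IHt].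
  rewrite /u_word big_nil; congr (\pi_A (mkmalgU _ 1)).
  by apply/eqP; rewrite fmP fm1.
rewrite u_word_cons IHt; apply: (etrans (nc_piM _ _)); congr (\pi_A _).
rewrite /gen malgM_def; apply: (etrans (fgmulUU _ _ _ _)).
rewrite mulr1; congr mkmalgU.
by apply/eqP; rewrite fmP fmM fmU.
Qed.

Lemma pi_malgU c (m : {fmonom I}) : \pi_A (mkmalgU m c) = c *: u_word K m.
Proof.
rewrite u_word_pi; apply: (etrans _ (esym (nilcoxeter_scaleE _ _))).
congr (\pi_A _); apply/malgP => m'.
have E (b : bool) : c *+ b = c * 1 *+ b by rewrite mulr1.
apply: (etrans (mcoeffU _ _ _)); apply: (etrans (E _)).
by apply/esym; rewrite mcoeffZ mcoeffU mulrnAr.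
Qed.

Lemma pi_sum (J : Type) (r : seq J) (F : J -> free_alg K k) :
  \pi_A (\sum_(j <- r) F j) = \sum_(j <- r) \pi_A (F j).
Proof.
apply: (big_morph (fun x : free_alg K k => \pi_A x)) => [x y|].
  exact/esym/nilcoxeter_addE.
by rewrite piE.
Qed.

Lemma nilcoxeter_span (y : free_alg K k) :
  \pi_A y = \sum_(m <- msupp y) mcoeff m y *: u_word K m.
Proof.
rewrite {1}[y]monalgE pi_sum; apply: eq_bigr => m _; exact: pi_malgU.
Qed.

(** Both conditions say that [t] and [s] are braid equivalent; on the right this is seen by
    attaching a path from [grass0] to [f] and cancelling it. *)
Lemma same_path s t f : ascending s (zero_state k) -> normal f -> ascending s f ->
  (ascending t (zero_state k) && (walk t (zero_state k) == walk s (zero_state k))) =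
  (ascending t f && (walk t f == walk s f)).
Proof.
move=> sr fn sf; apply/andP/andP => -[tu /eqP e].
  have ts : braid_eq K t s by apply: ascent_words_braid_eq (no_descent_zero_state
    (k := k)) tu sr e.
  by have [-> ->] := braid_eq_act hk f ts; rewrite sf eqxx.
have [x xg ef] := normal_reachable hk fn.
have ts : braid_eq K t s.
  by apply: (@braid_eq_cancel _ _ hk _ _ x);
    rewrite ?ascending_cat ?walk_cat ?ef ?xg ?tu.
by have [-> ->] := braid_eq_act hk (zero_state k) ts; rewrite sr eqxx.
Qed.

(** Words are grouped by their endpoint from [zero_state]. A group contributes a multiple of one
    reduced word [s], whose coefficient is read off by the indicator of [walk s f] at a normal [f]
    from which [s] ascends. *)
Lemma nil_act_faithful (x : A) :
  (forall v f, normal f -> nil_act v x f = 0) -> x = 0.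
Proof.
elim/quotW: x => y y0; rewrite nilcoxeter_span.
rewrite (partition_big_imfset _ (fun m : {fmonom I} => walk m (zero_state k))) /=.
rewrite big1_fset // => g _ _.
have [[s sr sg]|nex] := pselect (exists2 s, ascending s (zero_state k) & walk s
  (zero_state k) = g); last first.
  apply: big1 => m /eqP mg.
  have mr : ~~ ascending m (zero_state k) by apply/negP => mr; apply: nex; exists m.
  by rewrite (u_word_nonreduced K hk mr) scaler0.
rewrite (eq_bigr (fun m : {fmonom I} =>
    (mcoeff m y * (ascending m (zero_state k))%:R) *: u_word K s)) =>
      [|m /eqP mg]; last first.
  have [mr|mr] := boolP (ascending m (zero_state k)); last first.
    by rewrite (u_word_nonreduced K hk mr) scaler0 mulr0 scale0r.
  have [-> _ _ _] : braid_eq K m s.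
    by apply: (ascent_words_braid_eq K hk (no_descent_zero_state (k :=
      k)) mr sr); rewrite mg sg.
  by rewrite mulr1.
rewrite -scaler_suml big_mkcond /=.
have [f fn sf] := grass0_ascending_exists K hk sr.
rewrite (_ : \sum_(m <- _) _ = 0) ?scale0r //.
have := y0 (fun h => (h == walk s f)%:R) f fn; rewrite nil_actE // free_actE => e.
rewrite -[RHS]e; apply: eq_bigr => m _.
rewrite /walk_val -sg; have := same_path m sr fn sf.
case: (ascending m f); case: (walk m f == walk s f);
  case: (ascending m (zero_state k));
  by case: (walk m (zero_state k) == walk s (zero_state k)) => //= _;
    rewrite ?mulr1 ?mulr0.
Qed.

Lemma nil_act_inj (x y : A) :
  (forall v f, normal f -> nil_act v x f = nil_act v y f) -> x = y.
Proof.
move=> xy; apply/eqP; rewrite -subr_eq0; apply/eqP/nil_act_faithful => v f fn.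
by apply: (etrans (nil_actB hk v x y f)); rewrite xy // subrr.
Qed.

End Faithful.

(** * Beads and gaps of a partition *)

Section Partitions.
Implicit Types (nu la : seq nat) (r c q : nat) (z : int).

Lemma part_cons a nu : is_part (a :: nu) -> is_part nu.
Proof.
rewrite /is_part inE negb_or => /andP[/path_sorted -> /andP[_ ->]] //.
Qed.

Lemma part_cons_head a nu : is_part (a :: nu) -> (nth 0 nu 0 <= a)%N /\ (0 < a)%N.
Proof.
rewrite /is_part inE negb_or lt0n eq_sym => /andP[p /andP[-> _]]; split=> //.
by case: nu p => //= b nu /andP[].
Qed.

Lemma consP a nu : (nth 0 nu 0 <= a)%N -> (0 < a)%N -> is_part nu ->
  is_part (a :: nu).
Proof.
rewrite /is_part inE negb_or lt0n [0%N == a]eq_sym => h -> /andP[s ->];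
  rewrite !andbT.
by case: nu h s => //= b nu -> ->.
Qed.

Lemma part_count nu c q : is_part nu ->
  (q < count (fun p => c < p) nu)%N = (c < nth 0 nu q)%N.
Proof.
elim: nu q => [|a nu IH] q ap; first by rewrite nth_nil ltn0.
have np := part_cons ap; have [ha _] := part_cons_head ap.
have E : (c < a)%N = false -> (count (fun p => c < p) nu = 0)%N.
  move=> ca; apply/eqP; rewrite -leqn0 leqNgt IH // -leqNgt.
  by apply: leq_trans ha _; rewrite leqNgt ca.
case: q => [|q] /=; case: (boolP (c < a)%N) => [//|/negbTE ca].
- by rewrite E.
- by rewrite -IH // add1n ltnS.
- by rewrite -IH // E.
Qed.

Lemma part_nth nu q r : is_part nu -> (q <= r)%N -> (nth 0 nu r <= nth 0 nu q)%N.
Proof.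
move=> np qr; have [//|h] := leqP (nth 0 nu r) (nth 0 nu q).
have := part_count (nth 0 nu q) q np; rewrite ltnn => /negbT.
rewrite -leqNgt => h1; have := part_count (nth 0 nu q) r np; rewrite h.
by move=> h2; have := leq_trans h2 h1; rewrite ltnNge qr.
Qed.

Lemma part_size nu r : is_part nu -> (0 < nth 0 nu r)%N = (r < size nu)%N.
Proof.
case/andP=> _ n0; have [h|h] := ltnP r (size nu); last by rewrite nth_default.
by rewrite lt0n; apply: contraNneq n0 => <-; apply: mem_nth.
Qed.

(** Beyond the last row [nth] returns 0, so every sufficiently negative integer is a bead. *)
Definition bead nu r : int := (nth 0%N nu r)%:Z - r%:Z.
Definition beta nu z := exists r, z = bead nu r.
(** The integers that are not beads, listed by columns: c + 1 minus the length of column c. *)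
Definition gap nu c : int := c%:Z + 1 - (count (fun p => c < p)%N nu)%:Z.

Lemma bead_lt nu q r : is_part nu -> (q < r)%N -> bead nu r < bead nu q.
Proof. by move=> np qr; have := part_nth np (ltnW qr); rewrite /bead; lia. Qed.

Lemma beta_inj nu la : is_part nu -> is_part la ->
  (forall z, beta nu z <-> beta la z) -> nu = la.
Proof.
move=> np lp e.
have le r mu mu' : is_part mu -> is_part mu' -> (forall z, beta mu z ->
  beta mu' z) ->
    (forall q, (q < r)%N -> bead mu q = bead mu' q) -> bead mu r <= bead mu' r.
  move=> mp mp' h IH; have [q eq] := h _ (ex_intro _ r erefl).
  have [qr|rq] := ltnP q r; first by have := bead_lt mp qr; rewrite eq IH // ltxx.
  rewrite eq; case: (ltngtP r q) rq => // [rq|->] _ //.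
  exact/ltW/bead_lt.
have eb r : bead nu r = bead la r.
  elim/ltn_ind: r => r IH; apply/eqP; rewrite eq_le !le // => [z /e|q /IH|z /e] //.
have en r : nth 0%N nu r = nth 0%N la r by have := eb r; rewrite /bead; lia.
apply: (@eq_from_nth _ 0%N) => // ; apply/eqP; rewrite eqn_leq.
apply/andP; split; rewrite leqNgt.
  by rewrite -(part_size _ np) en nth_default.
by rewrite -(part_size _ lp) -en nth_default.
Qed.

Lemma hook_gap nu r c : is_part nu -> (c < nth 0 nu r)%N ->
  (hook nu r c)%:Z = bead nu r - gap nu c.
Proof.
move=> np cr; have := part_count c r np; rewrite cr /hook /bead /gap; lia.
Qed.

Lemma gap_not_beta nu c : is_part nu -> ~ beta nu (gap nu c).
Proof.
by move=> np [r]; have := part_count c r np; rewrite /bead /gap; lia.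
Qed.

Lemma gap_lt nu c c' : (c < c')%N -> gap nu c < gap nu c'.
Proof.
move=> cc'; rewrite /gap.
have : (count (fun p => c' < p) nu <= count (fun p => c < p) nu)%N.
  by apply: sub_count => p; apply: ltn_trans.
lia.
Qed.

Lemma gap_inj nu : injective (gap nu).
Proof.
move=> c c' e; case: (ltngtP c c') => // h; have := gap_lt nu h; lia.
Qed.

Lemma gap_surj nu r z : is_part nu -> ~ beta nu z -> z < bead nu r ->
  exists2 c, (c < nth 0 nu r)%N & gap nu c = z.
Proof.
move=> np nz zr.
have exq : exists q, bead nu q < z.
  exists (size nu + `|z|.+1)%N; rewrite /bead nth_default ?leq_addr //; lia.
case: (ex_minnP exq) => q qz qmin.
have rq : (r < q)%N.
  by rewrite ltnNge; apply/negP; rewrite leq_eqVlt => /orP[/eqP h|/(bead_lt np)];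
    [move: qz; rewrite h|]; lia.
case: q qz qmin rq => // q qz qmin rq.
have zq : z < bead nu q.
  have : ~~ (bead nu q < z) by apply/negP => /qmin; rewrite ltnn.
  have : bead nu q != z by apply/eqP => h; apply: nz; exists q.
  lia.
(* The bead of row q lies above z and that of row q + 1 below, so column z + q has exactly q + 1
   boxes and its gap is z. *)
have [c ec] : exists c : nat, c%:Z = z + q%:Z.
  by exists (absz (z + q%:Z)); move: qz; rewrite /bead; lia.
exists c; last first.
  have := part_count c q np; have := part_count c q.+1 np.
  by move: qz zq; rewrite /gap /bead; lia.
by have := part_nth np (q := r) (r := q); move: zq; rewrite /bead; lia.
Qed.

Lemma beta_cons a nu z : beta (a :: nu) z <-> z = a%:Z \/ beta nu (z + 1).
Proof.
split=> [[[|r] ->]|[->|[r e]]]; first by left; rewrite /bead /= subr0.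
- by right; exists r; rewrite /bead /=; lia.
- by exists 0%N; rewrite /bead /= subr0.
- by exists r.+1; move: e; rewrite /bead /=; lia.
Qed.

Lemma hook_cons a nu r c : is_part (a :: nu) -> (c < nth 0 nu r)%N ->
  hook (a :: nu) r.+1 c = hook nu r c.
Proof.
move=> ap cr; have [ha _] := part_cons_head ap.
have ca : (c < a)%N.
  by apply: leq_trans cr (leq_trans (part_nth (part_cons ap) (leq0n r)) ha).
by rewrite /hook /= ca; lia.
Qed.

Lemma coreP k nu : is_core k nu <->
  is_part nu /\ forall r c, (c < nth 0 nu r)%N -> hook nu r c != k.+1.
Proof.
rewrite /is_core; split=> [/andP[np /allP h]|[np h]]; last first.
  rewrite np; apply/allP => r _; apply/allP => c; rewrite mem_iota => /andP[_ ?].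
  exact: h.
split=> // r c cr; have rs : (r < size nu)%N.
  by rewrite -part_size //; apply: leq_ltn_trans cr.
have hr : r \in iota 0 (size nu) by rewrite mem_iota.
by have /allP/(_ c) := h r hr; rewrite mem_iota; apply.
Qed.

Lemma core_cons k a nu : is_core k (a :: nu) -> is_core k nu.
Proof.
case/coreP=> ap h; apply/coreP; split; first exact: part_cons ap.
by move=> r c cr; rewrite -(hook_cons ap cr); apply: h.
Qed.

Lemma bounded_of_core_cons k a nu : is_part (a :: nu) ->
  bounded_of_core k (a :: nu) =
  count (fun c => hook (a :: nu) 0 c <= k)%N (iota 0 a) :: bounded_of_core k nu.
Proof.
move=> ap; rewrite /bounded_of_core /= -[1%N]/(1 + 0)%N iotaDl -map_comp.
congr (_ :: _); apply/eq_in_map => r _ /=; apply: eq_in_count => c.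
by rewrite mem_iota => /andP[_ cr]; rewrite hook_cons.
Qed.

Lemma nth_filter_pos (s : seq nat) r : sorted geq s ->
  nth 0%N [seq p <- s | 0 < p]%N r = nth 0%N s r.
Proof.
elim: s r => //= a s IH r ps; have ss := path_sorted ps.
case: posnP => [a0|_]; last by case: r => //= r; apply: IH.
rewrite IH // {IH}; rewrite a0 in ps.
have {ps}s0 : all (geq 0) s.
  by apply: order_path_min ps => x y z yx xz; apply: leq_trans xz yx.
have s0' q : nth 0%N s q = 0%N.
  have [h|h] := ltnP q (size s); last exact: nth_default.
  by have := allP s0 _ (mem_nth 0%N h); rewrite /= leqn0 => /eqP.
by case: r => [|r] /=; rewrite ?a0 s0' ?s0'.
Qed.

End Partitions.

(** * States of cores *)

Section CoreStates.
Variable k : nat.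
Hypothesis hk : (0 < k)%N.
Local Notation I := 'I_k.+1.
Local Notation residue := (residue k).
Implicit Types (i j : I) (t : seq I) (f g : state k) (z : int).
Implicit Types (nu la : seq nat) (r c q a : nat).

(* For a core, [f i] is the least integer of residue i outside the set of
   beads. *)
Definition core_state nu f : Prop :=
  [/\ is_part nu, normal f & forall z, beta nu z <-> z < f (residue z)].

Lemma normal_residue f i : normal f -> residue (f i) = i.
Proof. by case=> /(cong_residue hk). Qed.

Lemma normal_inj f : normal f -> injective f.
Proof. by move=> fn i j e; rewrite -(normal_residue i fn) e normal_residue. Qed.

Lemma core_state_beta nu f z : core_state nu f -> beta nu z <-> z < f (residue z).
Proof. by case=> _ _; apply. Qed.

Lemma core_state_fun nu f g : core_state nu f -> core_state nu g -> f = g.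
Proof.
have le f' g' : core_state nu f' -> core_state nu g' -> forall i, g' i <= f' i.
  move=> [_ fn fb] [_ gn gb] i; rewrite leNgt; apply/negP.
  have := (gb (f' i)); rewrite (normal_residue i fn) => -[_ h] /h /fb.
  by rewrite (normal_residue i fn) ltxx.
by move=> rf rg; apply/ffunP => i; apply/eqP; rewrite eq_le !(le _ _ _ _ i).
Qed.

Lemma core_state_inj nu la f : core_state nu f -> core_state la f -> nu = la.
Proof.
move=> [np _ nb] [lp _ lb]; apply: beta_inj => // z.
by split=> [/nb/lb|/lb/nb].
Qed.

Lemma residue_gap z z' : residue z = residue z' -> z < z' -> z <= z' - k.+1%:Z.
Proof.
move=> /(residue_eq hk)[m ->] h; have [m0|m0] : m <= -1 \/ 0 <= m by lia.
  nia.
nia.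
Qed.

Lemma core_state_core nu f : core_state nu f -> is_core k nu.
Proof.
case=> np fn nb; apply/coreP; split=> // r c cr; apply/eqP => h.
have e : gap nu c = bead nu r + k.+1%:Z * (-1) by have := hook_gap np cr; lia.
apply: (@gap_not_beta nu c np); apply/nb; rewrite e (residueDn hk).
have /nb : beta nu (bead nu r) by exists r.
lia.
Qed.

Lemma core_state_nil : core_state [::] (grass0 k).
Proof.
split=> //; first exact: normal_grass0.
move=> z; have [m e] := residueE hk z; rewrite grassE.
have ik := ltn_ord (residue z).
have -> : beta [::] z <-> z <= 0.
  split=> [[r ->]|z0]; first by rewrite /bead nth_nil; lia.
  by exists (absz z); rewrite /bead nth_nil; lia.
move: e ik; move: (nat_of_ord (residue z)) => i -> ik; case: eqP => i0.
  by split; have [m0|m0] : m <= 0 \/ 1 <= m by [lia]; nia.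
by split; have [m0|m0] : m <= -1 \/ 0 <= m by [lia]; nia.
Qed.

(** Cells of hook length at most k are gaps in a window of k integers below the bead, hence of
    distinct residues. The gaps of residue i are its members from f(i) on, so the class meets the
    window in a gap exactly when f(i) is below the bead. *)
Lemma part_card nu f r : core_state nu f -> (r < size nu)%N ->
  count (fun c => hook nu r c <= k)%N (iota 0 (nth 0%N nu r)) =
  #|[pred i | f i < bead nu r]|.
Proof.
case=> np fn nb rs.
set H := fun c => _.
have HP c : c \in [seq c <- iota 0 (nth 0%N nu r) | H c] ->
    [/\ (c < nth 0 nu r)%N, gap nu c < bead nu r & bead nu r - k%:Z <= gap nu c].
  rewrite mem_filter mem_iota => /andP[h /andP[_ cr]].
  have hg := hook_gap np cr; have h' : (hook nu r c <= k)%N := h.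
  have h1 : (0 < hook nu r c)%N by rewrite /hook addn1.
  by split=> //; lia.
have u : uniq [seq residue (gap nu c) | c <- [seq c <- iota 0 (nth 0%N nu r) | H
  c]].
  rewrite map_inj_in_uniq ?filter_uniq ?iota_uniq // =>
    c c' /HP[_ h1 h2] /HP[_ h1' h2'].
  move=> /(residue_eq hk)[m e]; apply: (@gap_inj nu).
  have [m0|[m0|m0]] : m <= -1 \/ 1 <= m \/ m = 0 by lia.
  - by exfalso; nia.
  - by exfalso; nia.
  - by rewrite e m0; lia.
rewrite -size_filter -(size_map (fun c => residue (gap nu c))) -(card_uniqP u).
apply: eq_card => i; rewrite [in RHS]inE;
  apply/mapP/idP => [[c /HP[cr h1 h2] ->]|fi].
  apply: le_lt_trans h1; rewrite leNgt; apply/negP => /nb.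
  exact: gap_not_beta.
have bi : i != residue (bead nu r).
  apply: contraTneq fi => ->; rewrite -leNgt ltW //; apply/nb; by exists r.
(* f(i) + (k + 1)m is the largest integer of residue i not above the bead, hence within distance k
   of it. *)
pose m := ((bead nu r - f i) %/ k.+1%:Z)%Z.
have dm : bead nu r - f i = m * k.+1%:Z + ((bead nu r - f i) %% k.+1%:Z)%Z.
  exact: divz_eq.
have m0 : 0 <= ((bead nu r - f i) %% k.+1%:Z)%Z by apply: modz_ge0.
have mk : ((bead nu r - f i) %% k.+1%:Z)%Z < k.+1%:Z by apply: ltz_pmod.
have ri : residue (f i + k.+1%:Z * m) = i by rewrite (residueDn hk) normal_residue.
have fm : 0 <= m by rewrite divz_ge0 //; lia.
have nz : ~ beta nu (f i + k.+1%:Z * m) by move/nb; rewrite ri; nia.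
have lt : f i + k.+1%:Z * m < bead nu r.
  have : f i + k.+1%:Z * m != bead nu r by apply: contraNneq bi => <-; rewrite ri.
  lia.
have [c cr ec] := gap_surj np nz lt.
exists c; last by rewrite ec ri.
rewrite mem_filter mem_iota cr /= andbT /H.
by have := hook_gap np cr; rewrite ec; lia.
Qed.

(** Prepending a row [a] shifts the old beads down by one and adds the bead a. If a was the first
    gap of its class after the shift, the next one is a + k + 1. *)
Definition add_bead f a : state k :=
  [ffun i => if i == residue a then a%:Z + k.+1%:Z else f (nx i) - 1].

Lemma sum_nx f : \sum_(i < k.+1) f (nx i) = \sum_(i < k.+1) f i.
Proof.
have /(_ _) := reindex_inj (@nx_inj k).
by move=> h; rewrite [RHS]h.
Qed.

Lemma core_state_cons nu f a : core_state nu f -> (nth 0 nu 0 <= a)%N ->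
  (0 < a)%N ->
  f (residue (a%:Z + 1)) = a%:Z + 1 -> core_state (a :: nu) (add_bead f a).
Proof.
case=> np fn nb ha a0 fa; have fnx : f (nx (residue a)) = a%:Z + 1 by rewrite
  -(residueS hk).
split; first exact: consP.
  split.
    apply/(cong_residue hk) => i; rewrite ffunE; case: eqP => [->|_].
      by have := residueDn hk a 1; rewrite mulr1.
    have h : f (nx i) = (f (nx i) - 1) + 1 by lia.
    by apply: (@nx_inj k); rewrite -(residueS hk) -h normal_residue.
  have E i : add_bead f a i = f (nx i) - 1 + (if i == residue a then k.+1%:Z else
    0).
    by rewrite ffunE; case: eqP => [->|_]; [rewrite fnx; lia|rewrite addr0].
  case: fn => _ <-; rewrite (eq_bigr _ (fun i _ => E i)) big_split sumrB /=.
  rewrite -big_mkcond big_pred1_eq sumr_const card_ord sum_nx.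
  by rewrite -mulr_natl mulr1 natz subrK.
move=> z; rewrite beta_cons ffunE; case: eqP => [rz|rz].
  split=> [[->|]|h]; first by lia.
    move=> /nb; rewrite (residueS hk) rz fnx; lia.
  have [h1|h1] := ltP z a; first by right; apply/nb;
    rewrite (residueS hk) rz fnx; lia.
  left; apply/eqP; rewrite eq_le h1 andbT leNgt; apply/negP => h2.
  have := @residue_gap _ _ (esym rz) h2; lia.
split=> [[za|]|h]; first by rewrite za in rz.
  by move=> /nb; rewrite (residueS hk); lia.
by right; apply/nb; rewrite (residueS hk); lia.
Qed.

Lemma core_state_lt_head nu f z : core_state nu f -> (nth 0%N nu 0)%:Z < z ->
  ~ beta nu z.
Proof.
case=> np _ _ h [r e]; have := part_nth np (leq0n r).
by move: h; rewrite e /bead; lia.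
Qed.

(** With an earlier gap of [nu] in the class of a + 1, the integer a - (k + 1) would be a gap of the
    longer partition, giving a hook of length k + 1 in the first row. *)
Lemma core_head nu f a : is_core k (a :: nu) -> core_state nu f ->
  f (residue (a%:Z + 1)) = a%:Z + 1.
Proof.
move=> /coreP[ap core] rf; have [np fn nb] := rf.
have [ha a0] := part_cons_head ap.
have na : ~ beta nu (a%:Z + 1) by apply: (core_state_lt_head rf); lia.
have le : f (residue (a%:Z + 1)) <= a%:Z + 1 by rewrite leNgt; apply/negP => /nb.
apply/eqP; rewrite eq_le le leNgt; apply/negP => lt.
have := @residue_gap _ _ _ lt; rewrite (normal_residue _ fn) => /(_ erefl) le'.
have e : a%:Z - k.+1%:Z + 1 = a%:Z + 1 + k.+1%:Z * (-1) by lia.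
have nz : ~ beta (a :: nu) (a%:Z - k.+1%:Z).
  move=> /beta_cons[|]; first by lia.
  by rewrite e => /nb; rewrite (residueDn hk); lia.
have [|c ca ec] := @gap_surj _ 0%N _ ap nz; first by rewrite /bead /=; lia.
have := hook_gap ap ca; rewrite ec /bead /= => h.
by case/eqP: (core 0%N c ca); lia.
Qed.

Lemma core_core_state nu : is_core k nu -> exists f, core_state nu f.
Proof.
elim: nu => [|a nu IH] ac; first by exists (grass0 k); apply: core_state_nil.
have [f rf] := IH (core_cons ac); exists (add_bead f a).
have [ap _] := (coreP k (a :: nu)).1 ac; have [ha a0] := part_cons_head ap.
by apply: core_state_cons => //; apply: core_head ac rf.
Qed.

Lemma head_card nu f a : core_state nu f -> is_part (a :: nu) ->
  f (residue (a%:Z + 1)) = a%:Z + 1 ->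
  count (fun c => hook (a :: nu) 0 c <= k)%N (iota 0 a) =
  #|[pred i | f i < a%:Z + 1]|.
Proof.
move=> rf ap fa; have [ha a0] := part_cons_head ap.
rewrite (part_card (r := 0) (core_state_cons rf ha a0 fa)) //.
rewrite -!sum1_card [RHS](reindex_inj (@nx_inj k)); apply: eq_bigl => i.
rewrite !inE /bead /= subr0 ffunE; case: eqP => [->|_]; last by lia.
by rewrite -(residueS hk) fa; lia.
Qed.

Lemma card_lt (P Q : pred I) i :
  subpred P Q -> Q i -> ~~ P i -> (#|P| < #|Q|)%N.
Proof.
move=> PQ Qi Pi; apply/proper_card/properP; split; last by exists i.
by apply/fintype.subsetP => j; apply: PQ.
Qed.

Lemma rank_inj f i j : injective f ->
  #|[pred l | f l < f i]| = #|[pred l | f l < f j]| -> i = j.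
Proof.
move=> fi; suff lt i' j' : f i' < f j' ->
    (#|[pred l | (f l < f i')%R]| < #|[pred l | (f l < f j')%R]|)%N.
  move=> e; apply: fi; apply/eqP; case: (ltgtP (f i) (f j)) => // /lt.
    by rewrite e ltnn.
  by rewrite e ltnn.
move=> lt; apply: (@card_lt _ _ i'); rewrite /= ?ltxx //.
by move=> l /= /lt_trans; apply.
Qed.

Lemma rank_surj f q : injective f -> (q <= k)%N ->
  exists i, #|[pred l | f l < f i]| = q.
Proof.
move=> fi qk.
have rk i : (#|[pred l | (f l < f i)%R]| < k.+1)%N.
  rewrite -[X in (_ < X)%N]card_ord.
  by apply: (@card_lt _ predT i); rewrite //= ltxx.
have ri : injective (fun i => Ordinal (rk i)).
  by move=> i j /(congr1 val) /=; apply: rank_inj.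
have [g _ gK] := injF_bij ri; exists (g (Ordinal (qk : q < k.+1)%N)).
by have /(congr1 val) := gK (Ordinal (qk : q < k.+1)%N).
Qed.

(** The first part is the rank of a + 1 among the distinct values of the state of the remaining
    rows, so it determines the first row a. *)
Lemma bounded_of_core_inj nu la : is_core k nu -> is_core k la ->
  bounded_of_core k nu = bounded_of_core k la -> nu = la.
Proof.
elim: nu la => [|a nu IH] [|b la] //.
move=> ac bc; have [ap _] := (coreP k _).1 ac; have [bp _] := (coreP k _).1 bc.
rewrite !bounded_of_core_cons // => -[hd /(IH _ (core_cons ac) (core_cons bc)) e].
subst la; have [f rf] := core_core_state (core_cons ac).
have fa := core_head ac rf; have fb := core_head bc rf.
move: hd; rewrite !(head_card rf) // -[in LHS]fa -[in RHS]fb.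
have [_ fn _] := rf; move/(rank_inj (normal_inj fn)) => h.
by congr (_ :: _); move: fa; rewrite h fb; lia.
Qed.

(** The core is built from the bottom row up: the value of rank [q] in the state of the smaller
    core, minus 1, is the length of the new first row. *)
Lemma core_exists la : kbounded k la ->
  exists2 nu, is_core k nu & bounded_of_core k nu = la.
Proof.
elim: la => [|q la IH] /andP[qp lk0]; last have /= /andP[qk lk] := lk0.
  by exists [::]; rewrite // /is_core.
have [ha q0] := part_cons_head qp.
have [|nu nc nb] := IH; first by rewrite /kbounded (part_cons qp).
have [f rf] := core_core_state nc; have [np fn fb] := rf.
have [i ri] := rank_surj (normal_inj fn) qk.
have [j fj] : exists j, f j < f i.
  have : (0 < #|[pred l | (f l < f i)%R]|)%N by rewrite ri.
  by case/card_gt0P => j; rewrite inE => fj; exists j.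
(* For nonempty [nu] with first row b: if [f i <= b], fewer values would lie below [f i] than below
   the top bead, so [q] would be smaller than the head of [la]. *)
have [ge a0] : (nth 0%N nu 0)%:Z < f i /\ 2 <= f i.
  case: nu nb np nc rf {fb} => [|b nu] nb np nc rf.
    have g1 l : 1 <= f l.
      by rewrite (core_state_fun rf core_state_nil) grassE; case: eqP; lia.
    by have := g1 j; rewrite /=; lia.
  have [_ b0] := part_cons_head np; suff : b%:Z < f i by rewrite /=; lia.
  rewrite ltNge; apply/negP => fib.
  have bb : bead (b :: nu) 0 = b by rewrite /bead /= subr0.
  have fb' : b%:Z < f (residue b) by apply/(core_state_beta _ rf); exists 0%N.
  have {fib} fib : f i < b.
    rewrite lt_neqAle fib andbT; apply: contraTneq fb' => e.
    by rewrite -e (normal_residue _ fn) ltxx.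
  have /eqP := nb; rewrite bounded_of_core_cons //.
  have := part_card (r := 0) rf isT; rewrite bb /= => -> /eqP lae.
  move: ha; rewrite -lae /= -ri leqNgt => /negP[].
  apply: (@card_lt _ _ i); rewrite /= ?ltxx //.
  by move=> l /= /lt_trans; apply.
pose a := (absz (f i)).-1; have ea : a%:Z + 1 = f i by rewrite /a; lia.
have fa : f (residue (a%:Z + 1)) = a%:Z + 1 by rewrite ea (normal_residue _ fn).
have ap : is_part (a :: nu) by apply: consP => //; rewrite /a; lia.
have [ha' a0'] := part_cons_head ap.
exists (a :: nu); first exact: core_state_core (core_state_cons rf ha' a0' fa).
by rewrite bounded_of_core_cons // (head_card rf ap fa) ea ri nb.
Qed.

Lemma core_of_boundedP la : kbounded k la ->
  is_core k (core_of_bounded k la) /\ bounded_of_core k (core_of_bounded k la) = la.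
Proof.
move=> lk; have [nu nc nb] := core_exists lk.
apply: (@xgetPex _ _ [set nu | is_core k nu /\ bounded_of_core k nu = la]%classic).
by exists nu.
Qed.

Lemma nth_bounded nu f r : core_state nu f -> (r < size nu)%N ->
  nth 0%N (bounded_of_core k nu) r = #|[pred i | f i < bead nu r]|.
Proof.
move=> rf rs; rewrite /bounded_of_core (nth_map 0%N) ?size_iota // nth_iota //.
exact: part_card rf rs.
Qed.

Lemma size_bounded nu : size (bounded_of_core k nu) = size nu.
Proof. by rewrite size_map size_iota. Qed.

Lemma kbounded_of_core nu f : core_state nu f -> kbounded k (bounded_of_core k nu).
Proof.
move=> rf; have [np fn fb] := rf; rewrite /kbounded /is_part -andbA;
  apply/and3P; split.
- apply/(sortedP 0%N) => r; rewrite size_bounded => rs.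
  rewrite /= !(nth_bounded rf) //; last exact: ltnW.
  apply: subset_leq_card; apply/fintype.subsetP => i; rewrite !inE => /lt_trans;
    apply.
  exact: bead_lt.
- apply/(nthP 0%N) => -[r]; rewrite size_bounded => rs; rewrite (nth_bounded rf) //.
  move/eqP; rewrite -leqn0 leqNgt => /negP[]; apply/card_gt0P.
  have r0 : (0 < nth 0 nu r)%N by rewrite part_size.
  exists (residue (gap nu 0)); rewrite inE.
  have := hook_gap np r0; have : (0 < hook nu r 0)%N by rewrite /hook addn1.
  have : ~~ (gap nu 0 < f (residue (gap nu 0))).
    by apply/negP => /fb; apply: gap_not_beta.
  lia.
- apply/(all_nthP 0%N) => r; rewrite size_bounded => rs;
  rewrite (nth_bounded rf) //.
  rewrite -ltnS -[X in (_ < X)%N]card_ord.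
  apply: (@card_lt _ predT (residue (bead nu r))) => //=.
  rewrite -leNgt; apply/ltW/fb; by exists r.
Qed.

Lemma core_of_bounded_of_core nu f : core_state nu f ->
  core_of_bounded k (bounded_of_core k nu) = nu.
Proof.
move=> rf; have [c b] := core_of_boundedP (kbounded_of_core rf).
by apply: bounded_of_core_inj b => //; apply: core_state_core rf.
Qed.

End CoreStates.

(** * Ascending paths of cores *)

Section AscendingCores.
Variables (K : comNzRingType) (k : nat).
Hypothesis hk : (0 < k)%N.
Local Notation I := 'I_k.+1.
Local Notation residue := (residue k).
Implicit Types (i j : I) (t : seq I) (f g : state k) (z : int).
Implicit Types (nu la : seq nat) (r c q a : nat).

Lemma iter_nx i m : iter m (@nx k) i = i + inZp m.
Proof.
elim: m => [|m IH].
  by rewrite (_ : inZp 0 = 0) ?addr0 //; apply/val_inj; rewrite /= mod0n.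
rewrite /= IH /nx -addrA; congr (_ + _); apply/val_inj => /=.
by rewrite modnDml modnDmr addn1.
Qed.

Lemma contentE r c : content k r c = residue (c%:Z - r%:Z).
Proof.
have E m : inZp m = residue m%:Z by apply/val_inj => /=; rewrite modz_nat modn_mod.
apply/eqP; rewrite /content subr_eq -iter_nx -(residue_iter hk) subrK E; exact/eqP.
Qed.

Lemma addableE i nu r : is_part nu ->
  addable i nu r <-> (residue (bead nu r) = i /\ ~ beta nu (bead nu r + 1)).
Proof.
move=> np; rewrite /addable contentE -/(bead nu r).
split=> [/andP[h /eqP ->]|[-> nb]]; [split=> // -[q e]|rewrite eqxx andbT].
  have [qr|rq|qr] := ltngtP q r; last by move: e; rewrite qr; lia.
    case/orP: h => [/eqP r0|h]; first by rewrite r0 in qr.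
    case: r e h qr => // r; rewrite ltnS => e h qr.
    by have := part_nth np qr; move: e h; rewrite /bead /=; lia.
  by have := bead_lt np rq; lia.
case: r nb => // r nb /=; rewrite ltn_neqAle (part_nth np (leqnSn r)) andbT.
apply/eqP => e; apply: nb; exists r; rewrite /bead e; lia.
Qed.

(** Adding boxes moves up by one the beads of residue i whose upper neighbour is free. For an ascent
    these are the z of residue i with f(i + 1) - 1 <= z < f(i), so the ends of the two classes trade
    places. *)
Lemma core_state_s_act i nu f : core_state nu f -> ascent i f ->
  core_state (s_act i nu) (swap i f).
Proof.
move=> rf; have [np fn fb] := rf; rewrite /ascent => fi.
(* f(i + 1) and f(i) + 1 are congruent, so an ascent leaves a full k + 1 between them; hence some
   box is addable and [s_act] takes its first branch. *)
have fgap : f (nx i) <= f i + 1 - k.+1%:Z.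
  apply: (@residue_gap _ hk); last by lia.
  by rewrite (normal_residue hk _ fn) (residueS hk) (normal_residue hk _ fn).
have addP r : addable i nu r <-> (residue (bead nu r) = i /\
  ~ beta nu (bead nu r + 1)).
  exact: addableE.
have add_size r : addable i nu r -> (r < (size nu).+1)%N.
  case/addP=> _ nb; rewrite ltnS leqNgt; apply/negP => h; apply: nb.
  case: r h => // r h; exists r; rewrite /bead !nth_default //; last by lia.
    by lia.
have hasadd : has (addable i nu) (iota 0 (size nu).+1).
  have /fb[r er] : f i - k.+1%:Z < f (residue (f i - k.+1%:Z)).
    have -> : f i - k.+1%:Z = f i + k.+1%:Z * (-1) by lia.
    by rewrite (residueDn hk) (normal_residue hk _ fn); lia.
  have ri : residue (bead nu r) = i.
    rewrite -er; have -> : f i - k.+1%:Z = f i + k.+1%:Z * (-1) by lia.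
    by rewrite (residueDn hk) (normal_residue hk _ fn).
  have ar : addable i nu r.
    apply/addP; split=> //; rewrite fb (residueS hk) ri -er; lia.
  apply/hasP; exists r => //; rewrite mem_iota add0n; exact: add_size.
pose L := [seq (nth 0 nu r + addable i nu r)%N | r <- iota 0 (size nu).+1].
have sE : s_act i nu = [seq p <- L | (0 < p)%N] by rewrite /s_act hasadd.
have nthL r : nth 0%N L r = (nth 0 nu r + addable i nu r)%N.
  have [h|h] := ltnP r (size nu).+1.
    by rewrite (nth_map 0%N) ?size_iota // nth_iota.
  rewrite nth_default ?size_map ?size_iota // nth_default; last exact: ltnW.
  by case: (boolP (addable i nu r)) => // /add_size; rewrite ltnNge h.
have sL : sorted geq L.
  apply/(sortedP 0%N) => r _; rewrite !nthL /geq /=.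
  have := part_nth np (leqnSn r); case: (boolP (addable i nu r.+1)) => [|_].
    by case/andP=> /= h _ _; move: h; lia.
  by lia.
have nthE r : nth 0%N (s_act i nu) r = (nth 0 nu r + addable i nu r)%N.
  by rewrite sE nth_filter_pos.
have beadE r : bead (s_act i nu) r = bead nu r + (addable i nu r)%:Z.
  by rewrite /bead nthE; lia.
split.
- rewrite /is_part sE mem_filter ltnn andbT; apply: sorted_filter sL.
  by move=> x y z yx xz; apply: leq_trans xz yx.
- exact: (@normal_walk _ hk [:: i] f fn).
move=> z; split=> [[r ->]|].
  rewrite beadE; have br : beta nu (bead nu r) by exists r.
  case: (boolP (addable i nu r)) => [/addP[ri _]|nadd].
    by rewrite (residueS hk) ri swap_r //; move/fb: br; rewrite ri; lia.
  rewrite addr0; have [ri|ri] := eqVneq (residue (bead nu r)) i.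
    rewrite ri swap_l; have /fb : beta nu (bead nu r + 1).
      by apply: contrapT => nb; case/negP: nadd; apply/addP.
    by rewrite (residueS hk) ri; lia.
  have [rn|rn] := eqVneq (residue (bead nu r)) (nx i).
    by rewrite rn swap_r //; move/fb: br; rewrite rn; lia.
  by rewrite swap_out //; apply/fb.
have noadd r : ~ (residue (bead nu r) = i /\ ~ beta nu (bead nu r + 1)) ->
    beta (s_act i nu) (bead nu r).
  move=> h; exists r; rewrite beadE; case: (boolP (addable i nu r)) => [/addP //|_].
  by rewrite addr0.
have [ri|ri] := eqVneq (residue z) i.
  rewrite ri swap_l => h; have b1 : beta nu (z + 1) by apply/fb;
    rewrite (residueS hk) ri; lia.
  have [r er] : beta nu z by apply/fb; rewrite ri; lia.
  by rewrite er; apply: noadd; rewrite -er => -[_].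
have [rn|rn] := eqVneq (residue z) (nx i); last first.
  rewrite swap_out // => /fb [r er]; rewrite er; apply: noadd; rewrite -er => -[e].
  by rewrite e eqxx in ri.
rewrite rn swap_r // => h.
have [[r er]|nb] := pselect (beta nu z).
  by rewrite er; apply: noadd; rewrite -er => -[e]; rewrite e eqxx in ri.
have zz : z - 1 + 1 = z by lia.
have ri' : residue (z - 1) = i by apply: (@nx_inj k); rewrite -(residueS hk) zz.
have [r er] : beta nu (z - 1) by apply/fb; rewrite ri'; lia.
have ar : addable i nu r by apply/addP; rewrite -er zz.
by exists r; rewrite beadE ar -er; lia.
Qed.

Lemma core_state_word t : ascending t (grass0 k) ->
  core_state (foldr (@s_act k) [::] t) (walk t (grass0 k)).
Proof.
elim: t => [|i t IH] /=; first by move=> _; apply: core_state_nil.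
by case/andP=> /IH rt; apply: core_state_s_act.
Qed.

Lemma normal_core f : normal f -> exists nu, core_state nu f.
Proof. by move=> /(normal_reachable hk)[t tu <-];
  exists (foldr (@s_act k) [::] t); apply: core_state_word. Qed.

(** [w_] is a choice among minimal representatives carrying the empty core to the given one; one
    exists by reachability, and any of them ascends from [grass0] to the same state. *)
Lemma u_partP la : kbounded k la ->
  exists f t, [/\ core_state (core_of_bounded k la) f, ascending t (grass0 k),
    walk t (grass0 k) = f & u_part K k la = u_word K t].
Proof.
move=> lk; have [cc _] := core_of_boundedP hk lk.
have [f rf] := core_core_state hk cc; have [_ fn _] := rf.
have act_core_state w : in_minW0 w ->
    core_state (act w [::]) (walk (reduced_word w) (grass0 k)).
  by move=> wm; apply/core_state_word/(minW0_ascending_grass0 K).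
have [wm wa] : in_minW0 (w_ k la) /\ act (w_ k la) [::] = core_of_bounded k la.
  apply: (@xgetPex _ _ [set w | in_minW0 w /\
    act w [::] = core_of_bounded k la]%classic).
  have [t tu tf] := normal_reachable hk fn.
  have wm := ascending_grass0_minW0 K hk tu.
  exists (s_word t); split=> //; apply: (core_state_inj (act_core_state _ wm)).
  have [e _] := reduced_wordP (s_word t).
  by rewrite (walk_s_word hk _ e) tf.
exists f, (reduced_word (w_ k la)); split=> //.
  exact: (minW0_ascending_grass0 K).
by apply: (core_state_fun hk _ rf); rewrite -wa; apply: act_core_state.
Qed.

Lemma u_part_walk f t : normal f -> ascending t (grass0 k) ->
  walk t (grass0 k) = f ->
  exists2 nu, core_state nu f & u_part K k (bounded_of_core k nu) = u_word K t.
Proof.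
move=> fn tu tf; have [nu rf] := normal_core fn; exists nu => //.
have [f' [t' [rf' tu' tf' ->]]] := u_partP (kbounded_of_core hk rf).
rewrite (core_of_bounded_of_core hk rf) in rf'.
have ff' := core_state_fun hk rf rf'.
by have [] := ascent_words_braid_eq K hk (no_descent_grass0 hk) tu' tu;
  rewrite ?tf ?tf' ?ff'.
Qed.

End AscendingCores.

(** * Rows, and the two-row symmetry *)

Section Rows.
Variables (K : comNzRingType) (k : nat).
Hypothesis hk : (0 < k)%N.
Local Notation I := 'I_k.+1.
Local Notation nx := (@nx k).
Implicit Types (i x y : I) (s t : seq I) (f g : state k) (D : {set I}).
Implicit Types (a b j l p q m : nat).

Lemma decE t : dec t = pairwise (fun x y => (x != y) && (nx x != y)) t.
Proof.
elim: t => //= i t ->; rewrite andbA; congr (_ && _).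
elim: t => //= x t IH; rewrite -IH !inE !negb_or.
by case: (i != x); case: (nx i != x); rewrite /= ?andbF.
Qed.

Lemma dec_uniq t : dec t -> uniq t.
Proof. by elim: t => //= i t IH /and3P[-> _ /IH]. Qed.

Lemma braid_eq_pull i s t : (forall x, x \in s -> ~~ adjacent x i) ->
  braid_eq K (s ++ i :: t) (i :: s ++ t).
Proof.
elim: s => [|x s IH] h //=.
apply: (@braid_eq_trans _ _ _ [:: x, i & s ++ t]).
  by apply/braid_eq_cons/IH => y ys; apply: h; rewrite inE ys orbT.
by apply: braid_eq_comm; apply: h; rewrite inE eqxx.
Qed.

(** The head i of [s] can be pulled to the front of [t]: a letter x before it there is not i - 1
    because [t] is decreasing, nor i + 1 because [s] is. *)
Lemma dec_braid_eq s t : dec s -> dec t -> s =i t -> braid_eq K s t.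
Proof.
elim: s t => [|i s IH] t.
  by case: t => [|x t] _ _ // /(_ x); rewrite !inE eqxx.
move=> /= /and3P[si sni sd] td st.
have it : i \in t by rewrite -st inE eqxx.
case/splitPr: it td st => t1 t2 td st.
have := td; rewrite decE pairwise_cat -!decE =>
  /and3P[/allrelP h t1d] /= /and3P[it2 nit2 t2d].
have h1 x : x \in t1 -> x != i /\ nx x != i.
  by move=> xt1; apply/andP/h; rewrite ?inE ?eqxx.
apply: (braid_eq_trans _ (braid_eq_sym (braid_eq_pull t2 _))) => [|x xt1];
  last first.
  have [xi nxi] := h1 x xt1.
  rewrite adjacentE negb_or [i == nx x]eq_sym nxi andbT.
  apply: contraNneq sni => e; have := st (nx i).
  by rewrite inE nx_neq //= => ->; rewrite mem_cat -e xt1.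
apply: braid_eq_cons; apply: IH => // [|x].
  rewrite decE pairwise_cat -!decE t1d t2d !andbT; apply/allrelP => x y xt1 yt2.
  by apply: h; rewrite ?inE ?yt2 ?orbT.
have := st x; rewrite !mem_cat !inE; have [->|_ //] := eqVneq x i.
move=> _; rewrite (negbTE si) (negbTE it2) orbF; apply/esym/negP => /h1[].
by rewrite eqxx.
Qed.

(** The value at the bottom [x] of the run gains 1 at each of its l + 1 steps; the inequality is the
    ascent at the last one. *)
Lemma dec_run t f x l : dec t -> ascending t f ->
  (forall p, (p <= l)%N -> iter p nx x \in t) -> (forall y, x = nx y ->
    y \notin t) ->
  f (iter l.+1 nx x) <= f x + l%:Z /\
  (iter l.+1 nx x \notin t -> walk t f (iter l.+1 nx x) = f x + l%:Z + 1).
Proof.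
elim: t l => [|i t IH] l td tf run pre; first by have := run 0%N isT.
have /= /and3P[it nit td'] := td; have /= /andP[tf' ui] := tf.
have pre' y : x = nx y -> y \notin t.
  by move/pre; rewrite inE negb_or => /andP[].
have eff z := dec_effect hk td' tf' z.
have nlast p : (p < l)%N -> iter p nx x != i.
  move=> pl; apply: contraNneq nit => e; have := run p.+1 pl.
  by rewrite iterS e inE nx_neq.
have run' p : (p < l)%N -> iter p nx x \in t.
  by move=> pl; have := run p (ltnW pl); rewrite inE (negbTE (nlast p pl)).
have [e|ne] := eqVneq (iter l nx x) i; last first.
  have [|h1 h2] := IH l td' tf' _ pre'.
    move=> p; rewrite leq_eqVlt => /orP[/eqP ->|]; last exact: run'.
    by have := run l (leqnn l); rewrite inE (negbTE ne).
  split=> //; rewrite inE negb_or => /andP[n1 n2].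
  rewrite [walk _ _]/= swap_out ?h2 //.
  by apply: contra ne => /eqP/(@nx_inj _)->.
have en : walk t f (nx i) = f (nx i).
  by have := eff (nx i); rewrite (negbTE nit) => -[_ _]; apply => y /(@nx_inj _) <-.
have ei : walk t f i = f x + l%:Z.
  case: l run pre e nlast run' => [|l] run pre /= e nlast run'.
    rewrite -e addr0; have := eff x; rewrite e (negbTE it) => -[_ _]; apply=> y.
    by rewrite -e; apply: pre'.
  have [|_ h2] := IH l td' tf' _ pre'; first by move=> p; apply: run'.
  by move: h2; rewrite /= e => /(_ it) ->; lia.
by move: ui; rewrite /= e /ascent en ei /= swap_r // ei; split; lia.
Qed.

(** Naturals beyond k are allowed, so that runs through residue 0 stay intervals; [idx k] is the
    residue -1, the content of the first box of the second row. *)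
Definition idx m : I := residue k m%:Z.

Lemma nx_idx m : nx (idx m) = idx m.+1.
Proof. by rewrite -(residueS hk) /idx; congr residue; lia. Qed.

Lemma iter_idx p m : iter p nx (idx m) = idx (m + p).
Proof. by rewrite -(residue_iter hk) /idx PoszD. Qed.

Lemma val_idx m : (m <= k)%N -> idx m = m :> nat.
Proof. exact: residue_small. Qed.

Lemma idx_val x : idx x = x.
Proof. exact/val_inj/(val_idx (ltn_ord x)). Qed.

Lemma idx_eq m p : idx m = idx p -> exists q : int, m%:Z = p%:Z + k.+1%:Z * q.
Proof. exact: residue_eq. Qed.

Lemma idx_neq m p : (p < m <= p + k)%N -> idx m != idx p.
Proof.
move=> h; apply/eqP => /idx_eq[q e].
by have [q0|q0] : q <= 0 \/ 1 <= q by [lia]; nia.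
Qed.

Lemma idx_neq' m p : (m < p <= m + k)%N -> idx m != idx p.
Proof. by rewrite eq_sym; apply: idx_neq. Qed.

Lemma oD m : idx (k.+1 + m) = idx m.
Proof. by rewrite /idx PoszD -[X in residue k (X + _)]mulr1 addrC (residueDn hk).
  Qed.

Lemma mem_traject_idx x m b :
  reflect (exists2 p, (p < b)%N & x = idx (m + p)) (x \in traject nx (idx m) b).
Proof.
by apply: (iffP trajectP) => -[p pb e]; exists p => //; rewrite e iter_idx.
Qed.

Lemma idx_surj m x : exists2 p, (p <= k)%N & x = idx (m + p).
Proof.
have [q e] := residueE hk (x%:Z - m%:Z); set y := residue k _ in e.
exists y; first by rewrite -ltnS.
rewrite -[LHS]idx_val /idx; have -> : x%:Z = (m + y)%N%:Z + k.+1%:Z * q by lia.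
by rewrite (residueDn hk).
Qed.

Lemma dec_traject m b : (b <= k)%N -> dec (rev (traject nx (idx m) b)).
Proof.
elim: b => //= b IH bk; rewrite -/(traject nx (idx m) b.+1) trajectSr rev_rcons /=.
rewrite iter_idx nx_idx !mem_rev IH 1?ltnW // andbT; apply/andP; split.
  apply/mem_traject_idx => -[p pb] /eqP; apply/negP; apply: idx_neq; lia.
apply/mem_traject_idx => -[p pb] /eqP; apply/negP; apply: idx_neq; lia.
Qed.

(** Out of [i] letters acting on a row of length [j], [a] form a separate run for the second row. If
    [a] is positive, j + i - a < k keeps the runs from [idx j] and [idx k] apart. *)
Definition row_cond a (i : nat) j :=
  (a == 0)%N || [&& (a <= i)%N, (a <= j)%N & (i + j - a < k)%N].

Definition row_word a b j :=
  rev (traject nx (idx k) a) ++ rev (traject nx (idx j) b).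

Lemma row_condP a (i : nat) j : row_cond a i j -> (i <= k)%N ->
  a = 0%N \/ [/\ (a <= i)%N, (a <= j)%N & (j + (i - a) < k)%N].
Proof. by case/orP=> [/eqP ->|/and3P[]]; [left|right; split=> //; lia]. Qed.

Lemma dec_row_word a (i : nat) j : (i <= k)%N -> row_cond a i j ->
  dec (row_word a (i - a) j).
Proof.
move=> ik /row_condP/(_ ik)[->|[ai aj h]];
  first by rewrite /row_word /= subn0 dec_traject.
rewrite decE pairwise_cat -!decE !dec_traject ?andbT; try lia.
apply/allrelP => x y; rewrite !mem_rev =>
  /mem_traject_idx[p pa ->] /mem_traject_idx[q qb ->].
by rewrite nx_idx !idx_neq //; lia.
Qed.

(** For j at most k, the state of the one-row partition of length [j]: the bead 0 of the empty
    partition has become j. *)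
Definition row_state j : state k :=
  [ffun x => if x == idx j then k.+1%:Z + j%:Z else (x : nat)%:Z].

Lemma rowE j x : row_state j x = if x == idx j then k.+1%:Z + j%:Z else (x :
  nat)%:Z.
Proof. by rewrite ffunE. Qed.

Definition col_word m := rev (traject nx (idx 0) m).

Lemma col_word_row j : (j <= k)%N ->
  ascending (col_word j) (grass0 k) /\ walk (col_word j) (grass0 k) = row_state j.
Proof.
elim: j => [|j IH] jk.
  split=> //=; apply/ffunP => x; rewrite rowE grassE addr0 -val_eqE.
  by rewrite [val (idx 0)]val_idx.
have [u e] := IH (ltnW jk).
rewrite /col_word trajectSr rev_rcons /= -/(col_word j) iter_idx add0n u e
  /ascent nx_idx !rowE eqxx.
have h : idx j.+1 != idx j by apply: idx_neq; lia.
rewrite (negbTE h) val_idx //; split; first by lia.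
apply/ffunP => x; rewrite rowE; have [->|xj] := eqVneq x (idx j).
  by rewrite swap_l nx_idx rowE (negbTE h) eq_sym (negbTE h) !val_idx //; lia.
rewrite -nx_idx; have [->|xj'] := eqVneq x (nx (idx j));
  first by rewrite swap_r // rowE eqxx; lia.
by rewrite swap_out // rowE (negbTE xj).
Qed.

Lemma back_run D x : D \proper [set: I] -> x \in D ->
  exists y p, [/\ forall q, (q <= p)%N -> iter q nx y \in D, x = iter p nx y
                & forall z, y = nx z -> z \notin D].
Proof.
move=> /properP[_ [z _ zD]] xD.
have ex : exists p, `[< exists2 y, x = iter p nx y & y \notin D >].
  have [p _ e] := idx_surj z x; exists p; apply/asboolP; exists z => //.
  by rewrite e -iter_idx idx_val.
case: (ex_minnP ex) => -[|p] /asboolP[y e yD] pmin.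
  by rewrite /= in e; rewrite -e xD in yD.
exists (nx y), p; split=> [q qp||u /(@nx_inj _) <- //]; last by rewrite e iterSr.
apply/negPn/negP => h.
have /pmin : `[< exists2 y, x = iter (p - q) nx y & y \notin D >].
  by apply/asboolP; exists (iter q nx (nx y)); rewrite // -iterD subnK // e iterSr.
lia.
Qed.

(** The lowest letter of a run acts first, so it must ascend at [row_state j] itself, which only
    [idx j] and, for positive [j], [idx k] do. Every letter of [D] lies in a run starting there. *)
Lemma ascent_row_word j D : (j <= k)%N -> D \proper [set: I] ->
  ascending (decreasing_word D) (row_state j) ->
  exists2 a, row_cond a #|D| j & D =i row_word a (#|D| - a) j.
Proof.
move=> jk Dp; have [_ mD _] := decreasing_wordP Dp.
have := dec_word Dp; set t := decreasing_word D in mD * => td tu.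
have [_ [z _ zD]] := properP Dp.
have exm m : exists p, idx (m + p) \notin D.
  by have [p _ e] := idx_surj m z; exists p; rewrite -e.
case: (ex_minnP (exm j)) => b bD bmin; case: (ex_minnP (exm k)) => a aD amin.
have inb p : (p < b)%N -> idx (j + p) \in D.
  by move=> pb; apply/negPn/negP => /bmin; rewrite leqNgt pb.
have ina p : (p < a)%N -> idx (k + p) \in D.
  by move=> pb; apply/negPn/negP => /amin; rewrite leqNgt pb.
have run x l : (forall p, (p <= l)%N -> iter p nx x \in D) ->
    (forall y, x = nx y -> y \notin D) ->
      row_state j (iter l.+1 nx x) <= row_state j x + l%:Z.
  move=> h1 h2; have [||//] := dec_run (l := l) (x := x) td tu.
    by move=> p /h1; rewrite mD.
  by move=> y /h2; rewrite mD.
have bk : (b <= k)%N.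
  by have [p pk e] := idx_surj j z; apply: leq_trans (bmin p _) pk; rewrite -e.
have ak : (a <= k)%N.
  by have [p pk e] := idx_surj k z; apply: leq_trans (amin p _) pk; rewrite -e.
have cover x : x \in D -> (exists2 p, (p < b)%N & x = idx (j + p)) \/
    (0 < j)%N /\ exists2 p, (p < a)%N & x = idx (k + p).
  move=> /(back_run Dp)[y [p [h1 -> h2]]].
  have /= := run y 0%N _ h2; rewrite addr0.
  have p0 : (0 < p.+1)%N by [].
  move=> H; have {H} : row_state j (nx y) <= row_state j y by apply: H =>
    // -[|//] _; apply: (h1 0%N).
  rewrite !rowE; have [ey _|yj] := eqVneq y (idx j).
    left; exists p; last by rewrite ey iter_idx.
    rewrite ltnNge; apply/negP => /h1; rewrite ey iter_idx.
    exact/negP.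
  have [e h|ne] := eqVneq (nx y) (idx j).
    by have := ltn_ord y; lia.
  have [yk|yk] := eqVneq (y : nat) k.
    have ek : y = idx k by rewrite -[LHS]idx_val yk.
    move=> _; right; split.
      rewrite lt0n; apply: contraNneq ne => j0.
      by have := oD 0; rewrite addn0 ek nx_idx j0 => ->.
    exists p; last by rewrite ek iter_idx.
    rewrite ltnNge; apply/negP => /h1; rewrite ek iter_idx.
    exact/negP.
  by rewrite val_nx (negbTE yk); lia.
have card_eq s : uniq s -> D =i s -> #|D| = size s.
  by move=> us /eq_card ->; apply/card_uniqP.
(* In the first case nothing separate remains at [idx k]: either j = 0, or any letters of [D] from
   [idx k] on belong to the run from [idx j]. *)
have [jb|jb] := boolP ((j == 0)%N || (k - j <= b)%N).
  have Db : D =i rev (traject nx (idx j) b).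
    move=> x; rewrite mem_rev; apply/idP/mem_traject_idx => [|[p pb ->]];
      last exact: inb.
    case/cover=> [//|[j0 [p pa ->]]].
    have {jb} jb : (k - j <= b)%N by case/orP: jb => [/eqP e|//]; rewrite e in j0.
    exists (k - j + p)%N; last by rewrite addnA subnKC.
    rewrite ltnNge; apply/negP => h.
    have e : (j + b = k + (b - (k - j)))%N by lia.
    by move: bD; rewrite e ina //; lia.
  have cD := card_eq _ (dec_uniq (dec_traject j bk)) Db.
  rewrite size_rev size_traject in cD.
  by exists 0%N => // x; rewrite /row_word /= subn0 cD.
move: jb; rewrite negb_or -lt0n -ltnNge => /andP[j0 jb].
(* Otherwise the run from [idx k] carries the value k through j + 1 ascents onto [idx j], which
   requires k + 1 + j <= k + j. *)
have aj : (a <= j)%N.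
  apply: amin; apply/negP => /cover[[p pb]|[_ [p pa]]] /idx_eq[q e].
    have [q0|[q0|q0]] : q <= -1 \/ q = 0 \/ 1 <= q by lia.
    - by nia.
    - by rewrite q0 in e; lia.
    - by nia.
  have jp : (j <= p)%N.
    have [q0|[q0|q0]] : q <= -1 \/ q = 0 \/ 1 <= q by lia.
    - by nia.
    - by rewrite q0 in e; lia.
    - by nia.
  have := run (idx k) j; rewrite iter_idx !rowE.
  have -> : idx (k + j.+1) = idx j by rewrite -addSnnS oD.
  have -> : (idx k == idx j) = false by apply/negbTE/idx_neq; lia.
  rewrite eqxx val_idx // => H; suff : k.+1%:Z + j%:Z <= k%:Z + j%:Z by lia.
  apply: H => [p' pj'|y ey]; first by rewrite iter_idx; apply: ina; lia.
  have {ey} ey : y = idx k.-1.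
    by apply: (@nx_inj k); rewrite -ey nx_idx prednK.
  rewrite {y}ey; apply/negP => /cover[[p' pb']|[_ [p' pa']]] /idx_eq[q' e'].
    have [q0|[q0|q0]] : q' <= -1 \/ q' = 0 \/ 1 <= q' by lia.
    - by nia.
    - by rewrite q0 in e'; lia.
    - by nia.
  have [q0|[q0|q0]] : q' <= -1 \/ q' = 0 \/ 1 <= q' by lia.
  - have kp : (k <= p')%N by nia.
    by lia.
  - by rewrite q0 in e'; lia.
  - by nia.
have Dab : D =i row_word a b j.
  move=> x; rewrite /row_word mem_cat !mem_rev; apply/idP/orP.
    by move=> /cover[h|[_ h]]; [right|left]; apply/mem_traject_idx.
  by case=> /mem_traject_idx[p h ->]; [apply: ina|apply: inb].
have cond : row_cond a (a + b) j.
  by rewrite /row_cond; apply/orP; right; rewrite leq_addr aj /=; lia.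
have dab : dec (row_word a b j).
  have := dec_row_word (i := (a + b)%N) (a := a) (j := j); rewrite addKn;
    apply=> //; lia.
have cD := card_eq _ (dec_uniq dab) Dab.
rewrite size_cat !size_rev !size_traject in cD.
by exists a; rewrite cD ?addKn.
Qed.

Lemma row_cond_sym a (i : nat) j : row_cond a i j = row_cond a j i.
Proof. by rewrite /row_cond [(i + j)%N]addnC andbCA. Qed.

(* The right-hand side is symmetric in [i] and [j], whence h_i h_j = h_j h_i on
   the empty core, and everywhere by the Pieri rule. *)
Lemma row_sum (V : nmodType) (v : state k -> V) (i : nat) j : (i <= k)%N ->
  (j <= k)%N ->
  \sum_(D : {set I} | (D \proper [set: I]) && (#|D| == i))
    walk_val (decreasing_word D) v (row_state j) =
  \sum_(a < k.+1 | row_cond a i j)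
    walk_val (rev (traject nx (idx k) a) ++ col_word (i + j - a)) v (grass0 k).
Proof.
move=> ik jk; pose W (a : 'I_k.+1) := [set x in row_word a (i - a) j].
have ai (a : 'I_k.+1) : row_cond a i j -> (a <= i)%N.
  by case/row_condP/(_ ik) => [->|[]].
have cW (a : I) : row_cond a i j -> #|W a| = i.
  move=> ca; rewrite cardsE (card_uniqP (dec_uniq (dec_row_word ik ca))).
  by rewrite size_cat !size_rev !size_traject subnKC // ai.
have pW (a : I) : row_cond a i j -> W a \proper [set: I].
  move=> ca; rewrite properE subsetT /=; apply/negP => /subset_leq_card.
  by rewrite cW // cardsT card_ord; lia.
have eW (a : I) : row_cond a i j ->
  walk_val (decreasing_word (W a)) v (row_state j) =
    walk_val (rev (traject nx (idx k) a) ++ col_word (i + j - a)) v (grass0 k).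
  move=> ca; have [_ mW _] := decreasing_wordP (pW a ca).
  have /(braid_eq_act hk (row_state j)) [u e] :
      braid_eq K (decreasing_word (W a)) (row_word a (i - a) j).
    apply: dec_braid_eq (dec_word (pW a ca)) (dec_row_word ik ca) _ => x.
    by rewrite mW inE.
  have [uj ej] := col_word_row jk.
  have -> : col_word (i + j - a) = rev (traject nx (idx j) (i - a)) ++ col_word j.
    have -> : (i + j - a = j + (i - a))%N by have := ai a ca; lia.
    by rewrite /col_word trajectD rev_cat iter_idx.
  by rewrite catA (walk_val_cat _ (col_word j)) /walk_val uj ej u e.
have iW : {in [set a : 'I_k.+1 | row_cond a i j] &, injective W}.
  suff lt (a a' : 'I_k.+1) : row_cond a i j -> row_cond a' i j -> (a < a')%N ->
      W a <> W a'.
    move=> a a'; rewrite !inE => ca ca' e; apply/val_inj.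
    by case: (ltngtP a a') => // h; [case: (lt a a')|case: (lt a' a)].
  move=> ca ca' aa' /setP /(_ (idx (j + (i - a')))).
  have [a0|[a'i a'j h]] := row_condP ca' ik; first by rewrite a0 in aa'.
  rewrite !inE !mem_cat !mem_rev.
  have -> : idx (j + (i - a')) \in traject nx (idx j) (i - a).
    by apply/mem_traject_idx; exists (i - a')%N => //; lia.
  rewrite orbT => /esym/orP[] /mem_traject_idx[p pa] /eqP; apply/negP.
    by apply: idx_neq'; lia.
  by apply: idx_neq; lia.
rewrite (bigID (fun D => D \in W @: [set a : 'I_k.+1 | row_cond a i j])) /=.
rewrite [X in _ + X]big1 ?addr0 => [|D /andP[/andP[Dp /eqP Di] nD]]; last first.
  rewrite /walk_val; case: ifP => // uD; case/negP: nD.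
  have [a ca Da] := ascent_row_word jk Dp uD; rewrite Di in ca Da.
  have ak : (a < k.+1)%N by have [->|[]] := row_condP ca ik; lia.
  apply/imsetP; exists (Ordinal ak); first by rewrite inE.
  by apply/setP => x; rewrite inE Da.
rewrite (eq_bigl (fun D => D \in W @: [set a : 'I_k.+1 | row_cond a i j])) =>
  [|D]; last first.
  apply: andb_idl => /imsetP[a]; rewrite inE => ca ->.
  by rewrite pW //= cW.
by rewrite (big_imset _ iW); apply: eq_big => a; rewrite inE //; apply: eW.
Qed.

Lemma row_sum_sym (V : nmodType) (v : state k ->
  V) (i : nat) j : (i <= k)%N -> (j <= k)%N ->
  \sum_(D : {set I} | (D \proper [set: I]) && (#|D| == i))
    walk_val (decreasing_word D) v (row_state j) =
  \sum_(D : {set I} | (D \proper [set: I]) && (#|D| == j))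
    walk_val (decreasing_word D) v (row_state i).
Proof.
move=> ik jk; rewrite !row_sum //.
by apply: eq_big => [a|a _]; [apply: row_cond_sym|rewrite addnC].
Qed.

(** By symmetry, [i] letters acting on [row_state 0], the empty core, may be replaced by no letters
    acting on [row_state i]. *)
Lemma row0_sum (V : nmodType) (v : state k -> V) (i : nat) : (i <= k)%N ->
  \sum_(D : {set I} | (D \proper [set: I]) && (#|D| == i))
    walk_val (decreasing_word D) v (grass0 k) = v (row_state i).
Proof.
move=> ik; have [_ /= e0] := col_word_row (leq0n k); rewrite e0 row_sum_sym //.
rewrite (big_pred1 set0) => [|D]; last first.
  rewrite cards_eq0 andbC /=; case: eqVneq => [->|_] //=.
  by apply/properP; split; [apply: sub0set|exists (idx 0); rewrite inE].
have Dp : set0 \proper [set: I].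
  by apply/properP; split; [apply: sub0set|exists (idx 0); rewrite inE].
have [_ m0 _] := decreasing_wordP Dp.
suff -> : decreasing_word (set0 : {set I}) = [::] by rewrite /walk_val.
by case: (decreasing_word _) m0 => // x t /(_ x); rewrite !inE eqxx.
Qed.

End Rows.

(** * The k-Schur functions *)

Section KSchur.
Variables (K : comNzRingType) (k : nat).
Hypothesis hk : (0 < k)%N.
Local Notation I := 'I_k.+1.
Local Notation nx := (@nx k).
Local Notation A := (nilcoxeter K k).
Implicit Types (f g : state k) (D : {set I}) (nu la : seq nat).
Variable s : seq nat -> A.
Hypothesis hs : is_kSchur s.

Definition core_of f : seq nat := xget [::] [set nu | core_state nu f]%classic.
Definition bounded_state f : seq nat := bounded_of_core k (core_of f).

Lemma core_ofP f : normal f -> core_state (core_of f) f.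
Proof.
move=> /(normal_core hk)[nu rf];
  apply: (@xgetPex _ _ [set nu | core_state nu f]%classic).
by exists nu.
Qed.

Lemma kbounded_bounded_state f : normal f -> kbounded k (bounded_state f).
Proof. by move=> /core_ofP; apply: kbounded_of_core. Qed.

Lemma core_bounded_state f : normal f ->
  core_of_bounded k (bounded_state f) = core_of f.
Proof. by move=> /core_ofP; apply: core_of_bounded_of_core. Qed.

Lemma core_state_bounded_state nu f : core_state nu f ->
  bounded_state f = bounded_of_core k nu.
Proof.
move=> rf; have [_ fn _] := rf; rewrite /bounded_state; congr bounded_of_core.
exact: core_state_inj (core_ofP fn) rf.
Qed.

Lemma bounded_state_inj f g : normal f -> normal g ->
  bounded_state f = bounded_state g -> f = g.
Proof.
move=> fn gn e; have := core_ofP gn;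
  rewrite -(core_bounded_state gn) -e (core_bounded_state fn).
exact: core_state_fun (core_ofP fn).
Qed.

(** Turns the sum over partitions into one over [D]. Testing [u_mu = u_D u_la] at [grass0] on the
    constant 1 and on an indicator shows that [D] ascends and that [mu] is its endpoint; distinct
    [D] have distinct endpoints, since cancelling the common path leaves words with the same
    letters. *)
Lemma pieri (i : nat) f : normal f -> (1 <= i <= k)%N ->
  h_ K k i * s (bounded_state f) =
  \sum_(D : {set I} | (D \proper [set: I]) && (#|D| == i))
    walk_val (decreasing_word D) (fun g => s (bounded_state g)) f.
Proof.
move=> fn ik; have [_ _ hp] := hs; rewrite (hp _ _ ik (kbounded_bounded_state fn)).
have [f' [t [rf tu tf ut]]] := u_partP K hk (kbounded_bounded_state fn).
rewrite core_bounded_state // in rf;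
  have {rf} ef' := core_state_fun hk (core_ofP fn) rf.
rewrite -{f'}ef' in tf.
pose P (D : {set I}) := (D \proper [set: I]) && (#|D| == i).
pose Q := [set D : {set I} | P D && ascending (decreasing_word D) f]%SET.
have mem D : D \in Q = P D && ascending (decreasing_word D) f by rewrite inE.
have ascent_part D : D \proper [set: I] -> ascending (decreasing_word D) f ->
    u_part K k (bounded_state (walk (decreasing_word D) f)) = u_set K D * u_part
      K k (bounded_state f).
  move=> Dp uD; rewrite ut -u_word_cat.
  have [|||nu rnu <-] := @u_part_walk K _ hk (walk (decreasing_word D) f)
    (decreasing_word D ++ t).
  - exact: normal_walk.
  - by rewrite ascending_cat tu tf.
  - by rewrite walk_cat tf.
  by rewrite (core_state_bounded_state rnu).
have bij : pieri_set K k i (bounded_state f) =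
    ((fun D => bounded_state (walk (decreasing_word D) f)) @` [set` Q])%classic.
  apply/seteqP; split=> [mu [mk [D [Dp Di e]]]|mu [D /= DQ <-]].
    have [g [t' [rg tu' tg ut']]] := u_partP K hk mk.
    rewrite ut' ut -u_word_cat in e.
    have E (v : state k -> K) : walk_val t' v (grass0 k) = walk_val
      (decreasing_word D ++ t) v (grass0 k).
      by rewrite -!(nil_act_word hk) e.
    have uD : ascending (decreasing_word D) f.
      have := E (fun=> 1); rewrite /walk_val tu' ascending_cat tu tf;
        case: ifP => // _ /eqP.
      by rewrite oner_eq0.
    exists D => /=; first by rewrite mem /P Dp Di eqxx.
    have := E (fun h => (h == g)%:R);
      rewrite /walk_val tu' ascending_cat tu tf uD tg walk_cat tf eqxx.
    case: eqP => [-> _|_ /eqP]; last by rewrite oner_eq0.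
    by rewrite (core_state_bounded_state rg); have [_ ->] := core_of_boundedP hk mk.
  move: DQ; rewrite mem => /andP[/andP[Dp /eqP Di] uD]; split.
    exact/kbounded_bounded_state/normal_walk.
  by exists D; split=> //; apply: ascent_part.
have inj : set_inj [set` Q]%classic (fun D =>
  bounded_state (walk (decreasing_word D) f)).
  move=> D D' /set_mem /=; rewrite mem => /andP[/andP[Dp _] uD].
  move=> /set_mem /=; rewrite mem => /andP[/andP[Dp' _] uD'].
  move=> /(bounded_state_inj (normal_walk hk _ fn) (normal_walk hk _ fn)) e.
  have [_ _ _ m] : braid_eq K (decreasing_word D) (decreasing_word D').
    by apply: (@braid_eq_cancel K _ hk _ _ t);
      rewrite ?ascending_cat ?walk_cat ?tu ?tf.
  have [_ mD _] := decreasing_wordP Dp; have [_ mD' _] := decreasing_wordP Dp'.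
  by apply/setP => x; rewrite -mD -mD'.
rewrite bij fsbig_image // -(@bigfs _ _ _ _ (index_enum _) (fun D => D \in Q)).
- rewrite [RHS](bigID (fun D => ascending (decreasing_word D) f)) /=.
  rewrite [X in _ + X]big1 ?addr0 => [|D /andP[_ /negbTE uD]];
    last by rewrite /walk_val uD.
  by apply: eq_big => [D|D]; rewrite mem // /walk_val => /andP[_ ->].
- exact: index_enum_uniq.
- by move=> D _; rewrite mem_index_enum.
Qed.

Lemma normal_row j : (j <= k)%N -> normal (row_state k j).
Proof.
by move=> jk; have [_ <-] := col_word_row hk jk; apply/normal_walk/normal_grass0.
Qed.

Lemma bounded_state_grass0 : bounded_state (grass0 k) = [::].
Proof. by rewrite (core_state_bounded_state (core_state_nil hk)). Qed.

(** The Pieri rule at the empty partition. Since h_j is thus a k-Schur function, the Pieri rule also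
    computes the products h_i h_j. *)
Lemma s_row j : (1 <= j <= k)%N -> h_ K k j = s (bounded_state (row_state k j)).
Proof.
move=> jk; have [_ s0 _] := hs; have /andP[_ jk'] := jk.
rewrite -(row0_sum K hk (fun g =>
  s (bounded_state g)) jk') -(pieri (normal_grass0 hk) jk).
by rewrite bounded_state_grass0 s0 mulr1.
Qed.

Lemma h_comm i j : (1 <= i <= k)%N -> (1 <= j <= k)%N ->
  h_ K k i * h_ K k j = h_ K k j * h_ K k i.
Proof.
move=> ik jk; have [/andP[_ ik'] /andP[_ jk']] := (ik, jk).
rewrite [in LHS](s_row jk) [in RHS](s_row ik).
by rewrite !pieri //; [apply: (row_sum_sym K hk)|apply: normal_row|apply:
  normal_row].
Qed.

(** A centralizer is a subalgebra; used once for each factor. *)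
Lemma h_subalg_comm (x y : A) : in_h_subalg x -> in_h_subalg y -> x * y = y * x.
Proof.
have cl z : GRing.subalg_closed [pred y : A | y * z == z * y].
  split=> [|a u v|u v]; rewrite !inE; first by rewrite mul1r mulr1.
    by move=> /eqP e /eqP e'; rewrite mulrDl mulrDr -scalerAl e e' scalerAr.
  by move=> /eqP e /eqP e'; rewrite -mulrA e' mulrA e mulrA.
move=> xh yh; have xc i : (1 <= i <= k)%N -> x * h_ K k i = h_ K k i * x.
  move=> ik; apply/eqP; apply: (xh [pred y | y * h_ K k i == h_ K k i * y]) =>
    // j jk.
  by rewrite inE h_comm.
apply/esym/eqP; apply: (yh [pred y | y * x == x * y]) => // j jk.
by rewrite inE xc.
Qed.

Lemma nil_act_h (v : state k -> K) j f : nil_act v (h_ K k j) f =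
  \sum_(D : {set I} | (D \proper [set: I]) && (#|D| == j))
    walk_val (decreasing_word D) v f.
Proof. by rewrite nil_act_sum //; apply: eq_bigr => D _; apply: nil_act_word. Qed.

(* By triangularity: [normal_ind] isolates the term of [f] in the Pieri rule
   for the predecessor [g] of [f]. *)
Lemma kSchur_grass0 f : normal f -> forall v : state k -> K,
  nil_act v (s (bounded_state f)) (grass0 k) = v f.
Proof.
move: f; apply: (normal_ind hk) => [v|f g D gn jk Dp uD eD IHg IHD v].
  by have [_ s0 _] := hs; rewrite bounded_state_grass0 s0 nact1.
have := congr1 (fun x => nil_act v x (grass0 k)) (pieri gn jk).
rewrite nil_actM // IHg nil_act_h nil_act_sum //.
rewrite (bigD1 D) ?Dp ?eqxx //= [RHS](bigD1 D) ?Dp ?eqxx //=.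
rewrite /walk_val uD eD => /esym; set S := \sum_(_ | _) _; set S' := \sum_(_ | _) _.
suff -> : S = S' by move/addIr.
apply: eq_bigr => D' /andP[/andP[D'p /eqP cD'] D'D].
by case: ifP => uD'; [apply: IHD|rewrite nact0].
Qed.

Lemma nil_act_ext (v v' : state k -> K) x f : (forall g, normal g -> v g = v' g) ->
  normal f -> nil_act v x f = nil_act v' x f.
Proof.
move=> e fn; rewrite /nil_act !free_actE; apply: eq_bigr => m _; congr (_ * _).
by rewrite /walk_val e //; apply: normal_walk.
Qed.

End KSchur.

(** * The translation P and the rectangle *)

Section Translation.
Variable k : nat.
Hypothesis hk : (0 < k)%N.
Local Notation I := 'I_k.+1.
Local Notation nx := (@nx k).
Implicit Types (i l : I) (f : state k) (D : {set I}).
Variable c : nat.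
Local Notation sh i := (i + inZp c : I).

Definition rank f i := #|[pred l | (f l < f i)%R]|.

Definition translate f : state k :=
  [ffun i : I => let j : I := i - inZp c in
     f j + c%:Z - (if (rank f j < c)%N then k.+1%:Z else 0)].

Lemma translateE f i :
  translate f (sh i) = f i + c%:Z - (if (rank f i < c)%N then k.+1%:Z else 0).
Proof. by rewrite ffunE addrK. Qed.

Lemma nx_sh i : nx (sh i) = sh (nx i).
Proof. by rewrite /nx addrAC. Qed.

Lemma rank_lt f i l : f i < f l -> (rank f i < rank f l)%N.
Proof.
move=> lt; apply: (@card_lt _ _ _ i); rewrite /= ?ltxx //.
by move=> x /= /lt_trans; apply.
Qed.

Lemma normal_nx f i : normal f -> f (nx i) != f i.
Proof. by move=> fn; rewrite (inj_eq (normal_inj hk fn)) nx_neq. Qed.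

(** [rank] is monotone in the values, so lowering the [c] smallest ones preserves the order of any
    two. *)
Lemma ascent_translate f i : normal f -> ascent (sh i) (translate f) = ascent i f.
Proof.
move=> fn; rewrite /ascent nx_sh !translateE.
case: (ltgtP (f (nx i)) (f i)) (normal_nx i fn) => //= lt _.
  by have := rank_lt lt; do 2!case: ifP; lia.
by have := rank_lt lt; do 2!case: ifP; lia.
Qed.

(** f(i + 1) - 1 has residue i and f(i) + 1 has residue i + 1, so neither meets a value at a third
    place, and a shift by 1 cannot change an order without a meeting. *)
Lemma rank_swap f i l : normal f -> ascent i f ->
  rank (swap i f) l = rank f (tperm i (nx i) l).
Proof.
move=> fn; rewrite /ascent le_eqVlt (negbTE (normal_nx i fn)) /= => fi.
have fr x : residue k (f x) = x by apply: normal_residue.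
have o1 x : x != i -> f x != f (nx i) - 1.
  apply: contraNneq => e; have : f (nx i) = f x + 1 by lia.
  by move/(congr1 (residue k)); rewrite (residueS hk) !fr => /(@nx_inj k) ->.
have o2 x : x != nx i -> f x != f i + 1.
  by apply: contraNneq => /(congr1 (residue k)); rewrite (residueS hk) !fr => ->.
have o3 x : x != i -> f x != f i by rewrite (inj_eq (normal_inj hk fn)).
have o4 x : x != nx i -> f x != f (nx i) by rewrite (inj_eq (normal_inj hk fn)).
have lt x y : (swap i f x < swap i f y) = (f (tperm i (nx i) x) < f (tperm i (nx
  i) y)).
  rewrite !ffunE !permE /=.
  case: (eqVneq x i) => [_|xi]; case: (eqVneq y i) => [_|yi].
  - by rewrite !ltxx.
  - case: (eqVneq y (nx i)) => [_|yn]; first by lia.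
    by have := o1 y yi; have := o4 y yn; lia.
  - case: (eqVneq x (nx i)) => [_|xn]; first by lia.
    by have := o1 x xi; have := o4 x xn; lia.
  case: (eqVneq x (nx i)) => [_|xn]; case: (eqVneq y (nx i)) => [_|yn] //.
  - by rewrite !ltxx.
  - by have := o2 y yn; have := o3 y yi; lia.
  - by have := o2 x xn; have := o3 x xi; lia.
rewrite /rank -!sum1_card [RHS](reindex_inj (@perm_inj _ (tperm i (nx i)))).
by apply: eq_bigl => x; rewrite !inE lt.
Qed.

Lemma swap_translate f i : normal f -> ascent i f ->
  translate (swap i f) = swap (sh i) (translate f).
Proof.
move=> fn fi; apply/ffunP => x; rewrite -(subrK (inZp c) x).
move: (x - inZp c) => {}x; rewrite translateE rank_swap //.
have [->|xi] := eqVneq x i; first by rewrite !swap_l nx_sh translateE tpermL; lia.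
have [->|xn] := eqVneq x (nx i).
  by rewrite -nx_sh !swap_r // translateE tpermR; lia.
rewrite !swap_out ?nx_sh ?(inj_eq (addIr _)) // translateE tpermD //.
  by rewrite eq_sym.
by rewrite eq_sym.
Qed.

Lemma walk_val_translate (V : nmodType) t (v : state k -> V) f : normal f ->
  walk_val [seq sh i | i <- t] v (translate f) = walk_val t (v \o translate) f.
Proof.
move=> fn; suff [u e] : ascending [seq sh i | i <- t] (translate f) = ascending t
  f /\
    (ascending t f -> walk [seq sh i | i <- t] (translate f) = translate (walk t
      f)).
  by rewrite /walk_val u; case: ifP => // /e ->.
elim: t => //= i t [u e]; rewrite u.
have [tf|] //= := boolP (ascending t f); rewrite (e tf).
have gn : normal (walk t f) by apply: normal_walk.
by split=> [|ui]; rewrite ?ascent_translate ?swap_translate.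
Qed.

(** [decreasing_word] picks its own missing residue, so the shifted word need not be the word of the
    shifted set; both are decreasing with the same letters. *)
Lemma walk_val_sh (V : nmodType) D (v : state k -> V) f : D \proper [set: I] ->
  walk_val (decreasing_word [set sh x | x in D]) v f =
  walk_val [seq sh i | i <- decreasing_word D] v f.
Proof.
move=> Dp; have shI : injective (fun x : I => sh x) by exact: addIr.
have D'p : [set sh x | x in D] \proper [set: I].
  rewrite properEcard finset.subsetT cardsT card_imset //=.
  by have := proper_card Dp; rewrite cardsT.
have [_ mD _] := decreasing_wordP Dp; have [_ mD' _] := decreasing_wordP D'p.
have /(braid_eq_act hk f)[u e] : braid_eq int (decreasing_word [set sh x | x in D])
    [seq sh i | i <- decreasing_word D].
  apply: dec_braid_eq (dec_word D'p) _ _ => // [|x].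
    have := dec_word Dp; rewrite !decE pairwise_map; apply: sub_pairwise => x y /=.
    by rewrite nx_sh !(inj_eq shI).
  rewrite mD'; apply/imsetP/mapP => -[y yD ->]; exists y => //.
    by rewrite mD.
  by rewrite -mD.
by rewrite /walk_val u e.
Qed.

Variable K : comNzRingType.

(** Adding c permutes the proper subsets of a given cardinality, so h_j absorbs the shift of indices
    that a single u_i undergoes. *)
Lemma nil_act_h_translate (v : state k -> K) j f : normal f ->
  nil_act v (h_ K k j) (translate f) = nil_act (v \o translate) (h_ K k j) f.
Proof.
move=> fn; rewrite !nil_act_h //.
have shI : injective (fun x : I => sh x) by exact: addIr.
rewrite (reindex_inj (imset_inj shI)); apply: eq_big => D.
  by rewrite properEcard finset.subsetT cardsT card_imset // [RHS]andbC
    properEcard finset.subsetT cardsT andbC.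
rewrite properEcard finset.subsetT cardsT card_imset //= => /andP[h _].
by rewrite walk_val_sh ?walk_val_translate // properEcard finset.subsetT cardsT.
Qed.

Lemma nil_act_translate (x : nilcoxeter K k) : in_h_subalg x ->
  forall (v : state k -> K) f, normal f ->
  nil_act v x (translate f) = nil_act (v \o translate) x f.
Proof.
pose S : {pred nilcoxeter K k} := fun x => `[< forall (v : state k -> K) f,
  normal f -> nil_act v x (translate f) = nil_act (v \o translate) x f >].
have SP y : reflect (forall (v : state k -> K) f, normal f ->
    nil_act v y (translate f) = nil_act (v \o translate) y f) (y \in S) by apply:
      asboolP.
move=> xh; apply/SP/xh => [|j _]; last first.
  by apply/SP => v f fn; apply: nil_act_h_translate.
split=> [|a y z /SP yP /SP zP|y z /SP yP /SP zP]; apply/SP => v f fn.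
- by rewrite !nact1.
- by rewrite !nil_actD // !nil_actZ // yP // zP.
- by rewrite !nil_actM // zP //; apply: nil_act_ext => // g gn /=; apply: yP.
Qed.

Lemma grass0_nx (m : I) : grass0 k (nx m) = m%:Z + 1.
Proof.
by rewrite grassE val_nx; case: (m == k :> nat) / eqP => [->|_] /=; lia.
Qed.

Lemma rank_grass0 (m : I) : rank (grass0 k) (nx m) = m.
Proof.
rewrite /rank -sum1_card (reindex_inj (@nx_inj k)).
rewrite (eq_bigl (fun l : I => (l < m)%N)) => [|l];
  last by rewrite !inE !grass0_nx; lia.
by rewrite -(big_ord_widen _ (fun=> 1%N)) ?sum1_card ?card_ord // ltnW.
Qed.

(** * The rectangle as the translate of the empty core *)

Variable r : nat.
Hypotheses (hc : (1 <= c)%N) (hr : (1 <= r)%N) (hcr : (c + r = k.+1)%N).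

(** The largest hook, at the corner, is c + r - 1 = k; so the rectangle is a core and its own
    bounded partition. *)
Lemma hook_rect p q : (hook (nseq r c) p q <= k)%N.
Proof.
rewrite /hook count_nseq; have : (nth 0 (nseq r c) p <= c)%N.
  by rewrite nth_nseq; case: ifP.
case: (q < c)%N; lia.
Qed.

Lemma is_core_rect : is_core k (nseq r c).
Proof.
apply/coreP; split; last by move=> p q _; have := hook_rect p q; lia.
rewrite /is_part; apply/andP; split.
  by apply/(sortedP 0%N) => p; rewrite size_nseq !nth_nseq => h; rewrite h ltnW //=.
by apply/negP => /nseqP[]; lia.
Qed.

Lemma bounded_rect : bounded_of_core k (nseq r c) = nseq r c.
Proof.
apply: (@eq_from_nth _ 0%N) => [|p]; rewrite size_bounded // size_nseq => pr.
rewrite /bounded_of_core (nth_map 0%N) ?size_iota ?size_nseq // nth_iota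
  ?size_nseq //.
rewrite (eq_count (a2 := predT)) => [|q]; last by rewrite hook_rect.
by rewrite count_predT size_iota.
Qed.

(** The value m + 1 of [grass0], of rank m, becomes m + 1 - r if m < c and m + 1 + c otherwise. It
    is the first gap of its class: it is not a bead of the rectangle, while the integer k + 1 below
    it is. *)
Lemma core_state_rect : core_state (nseq r c) (translate (grass0 k)).
Proof.
have [f rf] := core_core_state hk is_core_rect;
  suff -> : translate (grass0 k) = f by [].
have [_ fn _] := rf; apply/ffunP => x.
have [y ->] : exists y, x = sh (nx y).
  exists (x - inZp c - inZp 1); rewrite /nx !subrK //.
rewrite translateE rank_grass0 grass0_nx; set w := _ - _.
have yk := ltn_ord y.
have rw : residue k w = sh (nx y).
  rewrite -iter_nx -[nx y](idx_val hk) (iter_idx hk) /idx.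
  have [m ey] := nx_mod hk y; rewrite PoszD ey.
  have -> : w = y%:Z + 1 + k.+1%:Z * m + c%:Z + k.+1%:Z *
      (- m - (if (y < c)%N then 1 else 0)) by rewrite /w; case: ifP; lia.
  exact: residueDn.
have nw : ~ w < f (sh (nx y)).
  rewrite -rw; move/(core_state_beta w rf) => [p]; rewrite /bead nth_nseq /w.
  by case: ifP; case: ifP; lia.
have lw : w - k.+1%:Z < f (sh (nx y)).
  have <- : residue k (w - k.+1%:Z) = sh (nx y).
    by rewrite -rw -[in RHS](residueDn hk w (-1)); congr residue; lia.
  (* For y < c this is the bead of an empty row below the rectangle; otherwise it is c - (k - y),
     the bead of a row of the rectangle, as k - y < r. *)
  apply/(core_state_beta _ rf); rewrite /w; case: (ltnP y c) => yc.
    exists (r + k - y)%N; rewrite /bead nth_nseq.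
    by case: ifP; lia.
  exists (k - y)%N; rewrite /bead nth_nseq.
  by case: ifP; lia.
have : residue k (f (sh (nx y))) = residue k w by rewrite rw normal_residue.
move=> /(residue_eq hk)[q eq]; move: nw lw; rewrite eq => nw lw.
have [q0|[q0|q0]] : q <= -1 \/ 1 <= q \/ q = 0 by lia.
- by exfalso; nia.
- by exfalso; nia.
- by rewrite q0 mulr0 addr0.
Qed.

End Translation.

Theorem theorem5p1 (K : comNzRingType) (k c r : nat)
    (hk : (1 <= k)%N) (hc : (1 <= c)%N) (hr : (1 <= r)%N)
    (hcr : (c + r = k.+1)%N)
    (s : seq nat -> nilcoxeter K k) (hs : is_kSchur s) (i : 'I_k.+1) :
  (s (nseq r c) * u_ K i = u_ K (i + inZp c) * s (nseq r c))%R.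
Proof.
have rect := core_state_rect hk hc hr hcr; set P := translate c (grass0 k) in rect.
have Pn : normal P by case: rect.
have bdP : bounded_state P = nseq r c by rewrite (core_state_bounded_state hk
  rect) bounded_rect.
have [sB _ _] := hs.
have bB f (fn : normal f) : in_h_subalg (s (bounded_state f)) :=
  sB _ (kbounded_bounded_state hk fn).
have key (v : state k -> K) f : normal f ->
    nil_act v (s (nseq r c)) f = v (translate c f).
  (* The element of the subalgebra that carries the empty core to [f] is the k-Schur function of [f]
     itself, so it commutes with s_R and with the translation. *)
  move=> fn; rewrite -(kSchur_grass0 hk hs fn (nil_act v _)) -nil_actM // -bdP.
  rewrite (h_subalg_comm hk hs (bB _ Pn) (bB _ fn)) nil_actM //.
  rewrite (kSchur_grass0 hk hs Pn) (nil_act_translate hk c (bB _ fn)) //.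
    exact: (kSchur_grass0 hk hs fn).
  exact: normal_grass0.
apply: (nil_act_inj hk) => v f fn.
have L : nil_act v (s (nseq r c) * u_ K i) f =
    if ascent i f then v (translate c (swap i f)) else 0.
  rewrite nil_actM // nil_act_u //; case: ifP => // _.
  by apply/key/(@normal_walk _ hk [:: i]).
have R : nil_act v (u_ K (i + inZp c) * s (nseq r c)) f =
    if ascent i f then v (translate c (swap i f)) else 0.
  rewrite nil_actM // key // nil_act_u // ascent_translate //; case: ifP => // fi.
  by rewrite swap_translate.
exact: etrans L (esym R).
Qed.
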